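(* Let $\Omega=\Omega(1,\infty)$ and let $\beta\in S_{\rm exterior}$, where $$S_{\rm exterior}=\left\{\beta>0 \ :\ \beta\neq \frac{k\int_0^{\infty}e^{-k\cosh(\theta)}\cosh^2(\theta)\,d\theta}{\int_0^{\infty}e^{-k\cosh(\theta)}\cosh(\theta)\,d\theta}\ \text{ for all } k\in\mathbb{Z}^{+}\right\}.$$ Consider the initial-boundary value problem in $\Omega$ for the 3D inviscid model $$\partial_t u=2u\,\partial_z\psi,\qquad \partial_t\omega=\partial_z(u^2),\qquad -\big(\partial_r^2+\tfrac{3}{r}\partial_r+\partial_z^2\big)\psi=\omega$$ with initial data $u(0,\cdot)=u_0\in H^3(\Omega)$, $\psi(0,\cdot)=\psi_0\in H^4(\Omega)$ satisfying $$u_0^2>0\ \text{ for } z\neq 0 \text{ and } z\neq 1,\qquad u_0|_{z=0}=u_0|_{z=1}=0,$$ and with the Neumann-Robin type boundary condition $$(\psi_r+\beta\psi)|_{r=1}=0,\qquad \psi_z|_{z=0}=\psi_z|_{z=1}=0.$$ Suppose in addition that $\beta\ge 2+2\sqrt{1+\frac{\pi^2}{4}}$, and put $\alpha=\frac{\beta}{2}$, $$\phi(r,z)=\theta(r)\sin(\pi z),\qquad \theta(r)=e^{-\alpha r^2},\qquad \Phi(r,z)=\phi_{rr}+\frac3r\phi_r+\phi_{zz},$$ $$c_0=\frac{3}{2\pi^2}\int_0^1\int_1^\infty\big(4\alpha^2r^2-(8\alpha+\pi^2)\big)^2\phi\, r^3\,dr\,dz .$$ Then the solution of the 3D inviscid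 model develops a finite time singularity in the $H^3$ norm provided that $$\int_0^1\int_1^\infty\Phi\,\log(u_0^2)\,r^3\,dr\,dz>0,\qquad \int_0^1\int_1^\infty\Phi\,\partial_z\psi_0\,r^3\,dr\,dz>0$$ and $$\Big(\int_0^1\int_1^\infty\partial_z\psi_0\,\Phi\,r^3\,dr\,dz\Big)^2\ \ge\ \frac{16}{c_0}\Big(\int_0^1\int_1^\infty(\log u_0^2)\,\Phi\,r^3\,dr\,dz\Big)^3 .$$
   Context: For $0\le\gamma_1<\gamma_2\le\infty$, let $$\Omega(\gamma_1,\gamma_2)=\Big\{(x_1,\dots,x_4,z)\in\mathbb{R}^5:\ \gamma_1\le r=\Big(\sum_{j=1}^4x_j^2\Big)^{1/2}<\gamma_2,\ 0\le z\le 1\Big\}.$$ All functions are axisymmetric, i.e. depend on space only through $(r,z)$ (and on time $t$), and are viewed as functions on $\Omega(\gamma_1,\gamma_2)\subset\mathbb{R}^5$; $H^s(\Omega)$ is the usual $L^2$-based Sobolev space on this five-dimensional domain. The unknowns are $u(t,r,z)$ and $\psi(t,r,z)$, with $\omega$ determined by $\psi$ through the third equation of the model. ''The solution'' is the unique local-in-time smooth solution of the initial-boundary value problem, with $u\in C([0,T),H^3(\Omega))$, $\psi\in C([0,T),H^4(\Omega))$ for some $T>0$, extended to its maximal time interval. Let $T_b$ be the largest time such that the problem has a unique smooth solution with $u(t)\in H^3(\Omega)$, $\psi(t)\in H^4(\Omega)$ for $0\le t<T_b$. ''Develops a finite time singularity in the $H^3$ norm'' means $T_b<\infty$; that is, there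 is no solution with $u\in C([0,\infty),H^3(\Omega))$ and $\psi\in C([0,\infty),H^4(\Omega))$. *)

(* Defs.v *)
From HB Require Import structures.
From mathcomp Require Import all_boot all_order all_algebra.
From mathcomp Require Import all_classical all_reals all_analysis.
Set Implicit Arguments.
Unset Strict Implicit.
Unset Printing Implicit Defensive.
Import Order.TTheory GRing.Theory Num.Theory.
Import numFieldNormedType.Exports.
Local Open Scope classical_set_scope.
Local Open Scope ring_scope.

(** * L2-based Sobolev spaces of integer order on subsets of R^5 *)

(* The point (x1, x2, x3, x4, z). *)
Notation R5 R := (R * R * R * R * R)%type (only parsing).

Definition leb5 (R : realType) :
    {measure set (R5 (measurableTypeR R)) -> \bar R} :=
  ((((@lebesgue_measure R \x @lebesgue_measure R)
       \x @lebesgue_measure R) \x @lebesgue_measure R)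
       \x @lebesgue_measure R)%E.

Arguments leb5 : clear implicits.

Definition basis5 (R : realType) (i : 'I_5) : R5 R :=
  let c (k : nat) : R := (i == k :> nat)%:R in (c 0, c 1, c 2, c 3, c 4)%N.

Definition partial5 (R : realType) (i : 'I_5) (f : R5 R -> R) :
    R5 R -> R :=
  fun x => 'D_(basis5 R i) f x.

(* The classical derivative of multi-index a. *)
Definition mpartial (R : realType) (a : 'I_5 -> nat)
    (f : R5 R -> R) : R5 R -> R :=
  foldr (fun i g => iter (a i) (partial5 i) g) f (enum 'I_5).

Definition smooth5 (R : realType) (f : R5 R -> R) : Prop :=
  forall s : seq 'I_5,
    let g := foldr (@partial5 R) f s in
    continuous g /\ forall x i, derivable g x (basis5 R i).

Definition test_function (R : realType) (U : set (R5 R))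
    (f : R5 R -> R) : Prop :=
  [/\ smooth5 f,
      compact (closure [set x | f x != 0]) &
      closure [set x | f x != 0] `<=` U°].

Definition L2 (R : realType) (U : set (R5 R))
    (f : R5 R -> R) : Prop :=
  measurable_fun U f /\ (\int[leb5 R]_(x in U) ((f x) ^+ 2)%:E < +oo)%E.

Definition L2_weak_partial (R : realType) (U : set (R5 R))
    (a : 'I_5 -> nat) (f g : R5 R -> R) : Prop :=
  L2 U g /\
  forall h, test_function U h ->
    \int[leb5 R]_(x in U) (f x * mpartial a h x) =
    (-1) ^+ (\sum_i a i)%N * \int[leb5 R]_(x in U) (g x * h x).

Definition sobolev (R : realType) (m : nat) (U : set (R5 R))
    (f : R5 R -> R) : Prop :=
  L2 U f /\
  forall a : {ffun 'I_5 -> 'I_m.+1}, (\sum_i a i <= m)%N ->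
    exists g, L2_weak_partial U (fun i => a i) f g.

(* The weak derivative is unique only up to a null set; one is chosen. *)
Definition weak_partial (R : realType) (U : set (R5 R))
    (a : 'I_5 -> nat) (f : R5 R -> R) : R5 R -> R :=
  xget (cst 0) [set g | L2_weak_partial U a f g].

Definition sobolev_norm (R : realType) (m : nat) (U : set (R5 R))
    (f : R5 R -> R) : R :=
  Num.sqrt (\sum_(a : {ffun 'I_5 -> 'I_m.+1} | (\sum_i a i <= m)%N)
    \int[leb5 R]_(x in U) (weak_partial U (fun i => a i) f x) ^+ 2).

(** * Axisymmetric functions on Omega(gamma_1, gamma_2) *)

Definition radius (R : realType) (x : R5 R) : R :=
  let: (x1, x2, x3, x4, _) := x in
  Num.sqrt (x1 ^+ 2 + x2 ^+ 2 + x3 ^+ 2 + x4 ^+ 2).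

Definition Omega (R : realType) (g1 : R) (g2 : \bar R) :
    set (R5 R) :=
  [set x | [/\ g1 <= radius x, ((radius x)%:E < g2)%E & 0 <= x.2 <= 1]].

Definition Omega_ext (R : realType) : set (R5 R) :=
  Omega (1 : R) +oo%E.
Arguments Omega_ext : clear implicits.

Definition axisym (R : realType) (f : R -> R -> R) : R5 R -> R :=
  fun x => f (radius x) x.2.

(* [0, T), where T may be +oo *)
Definition time_dom (R : realType) (T : \bar R) : set R :=
  [set t | 0 <= t /\ (t%:E < T)%E].

Definition in_sobolev_C (R : realType) (m : nat) (T : \bar R)
    (f : R -> R -> R -> R) : Prop :=
  (forall t, time_dom T t -> sobolev m (Omega_ext R) (axisym (f t))) /\
  (forall t, time_dom T t ->
     (fun s => sobolev_norm m (Omega_ext R)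
                 (fun x => axisym (f s) x - axisym (f t) x))
       @ within (time_dom T) (nbhs t) --> (0 : R)).

(** * Classical derivatives on the closed (r, z) domain *)

(* Derivative along A: one-sided at an end point of the interval A, two-sided
   at its interior points. *)
Definition diff_quot (R : realType) (f : R -> R) (x : R) : R -> R :=
  fun y => (f y - f x) / (y - x).

Definition derivable_in (R : realType) (A : set R) (f : R -> R) (x : R) : Prop :=
  cvg (diff_quot f x @ within A x^').

Definition derive_in (R : realType) (A : set R) (f : R -> R) (x : R) : R :=
  lim (diff_quot f x @ within A x^').

Definition r_dom (R : realType) : set R := `[1, +oo[.
Definition z_dom (R : realType) : set R := `[0, 1].
Arguments r_dom : clear implicits.
Arguments z_dom : clear implicits.

Definition d_r (R : realType) (f : R -> R -> R) (r z : R) : R :=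
  derive_in (r_dom R) (fun s => f s z) r.

Definition d_z (R : realType) (f : R -> R -> R) (r z : R) : R :=
  derive_in (z_dom R) (fun s => f r s) z.

Definition d_t (R : realType) (T : \bar R) (f : R -> R -> R -> R) (t r z : R) : R :=
  derive_in (time_dom T) (fun s => f s r z) t.

Definition laplace5 (R : realType) (f : R -> R -> R) (r z : R) : R :=
  d_r (d_r f) r z + 3 / r * d_r f r z + d_z (d_z f) r z.

Definition dom (R : realType) (T : \bar R) : set (R * R * R) :=
  [set p | [/\ time_dom T p.1.1, r_dom R p.1.2 & z_dom R p.2]].

Definition cont_on (R : realType) (T : \bar R) (f : R -> R -> R -> R) : Prop :=
  {within dom T, continuous (fun p : R * R * R => f p.1.1 p.1.2 p.2)}.

Definition C1_space (R : realType) (T : \bar R) (f : R -> R -> R -> R) : Prop :=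
  [/\ cont_on T f,
      forall t r z, dom T (t, r, z) ->
        derivable_in (r_dom R) (fun s => f t s z) r /\
        derivable_in (z_dom R) (fun s => f t r s) z,
      cont_on T (fun t => d_r (f t)) &
      cont_on T (fun t => d_z (f t))].

Definition C1_time (R : realType) (T : \bar R) (f : R -> R -> R -> R) : Prop :=
  [/\ cont_on T f,
      forall t r z, dom T (t, r, z) ->
        derivable_in (time_dom T) (fun s => f s r z) t &
      cont_on T (d_t T f)].

(** * The inviscid model in the exterior domain Omega(1, oo) *)

Definition vort (R : realType) (psi : R -> R -> R -> R) (t r z : R) : R :=
  - laplace5 (psi t) r z.

(* For axisymmetric functions on r >= 1, H^3 embeds in C^1 and H^4 in C^2 up to
   the boundary (the meridian domain is two-dimensional), so the classical
   regularity below only fixes the continuous representatives. *)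
Record solution (R : realType) (beta : R) (u0 psi0 : R -> R -> R) (T : \bar R)
    (u psi : R -> R -> R -> R) : Prop := Solution {
  sol_u_H3 : in_sobolev_C 3 T u;
  sol_psi_H4 : in_sobolev_C 4 T psi;
  sol_u_C1 : C1_space T u /\ C1_time T u;
  sol_psi_C2 : [/\ C1_space T psi, C1_space T (fun t => d_r (psi t)) &
                   C1_space T (fun t => d_z (psi t))];
  sol_vort_C1 : C1_time T (vort psi);
  sol_eq_u : forall t r z, dom T (t, r, z) ->
    d_t T u t r z = 2 * u t r z * d_z (psi t) r z;
  sol_eq_vort : forall t r z, dom T (t, r, z) ->
    d_t T (vort psi) t r z = d_z (fun r' z' => (u t r' z') ^+ 2) r z;
  sol_init : forall r z, r_dom R r -> z_dom R z ->
    u 0 r z = u0 r z /\ psi 0 r z = psi0 r z;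
  sol_bc_r : forall t z, time_dom T t -> z_dom R z ->
    d_r (psi t) 1 z + beta * psi t 1 z = 0;
  sol_bc_z : forall t r, time_dom T t -> r_dom R r ->
    d_z (psi t) r 0 = 0 /\ d_z (psi t) r 1 = 0
}.

Definition uniquely_solvable (R : realType) (beta : R) (u0 psi0 : R -> R -> R)
    (T : \bar R) : Prop :=
  exists u psi, solution beta u0 psi0 T u psi /\
    forall v chi, solution beta u0 psi0 T v chi ->
      forall t r z, dom T (t, r, z) ->
        v t r z = u t r z /\ chi t r z = psi t r z.

(* The blow-up time T_b. *)
Definition lifespan (R : realType) (beta : R) (u0 psi0 : R -> R -> R) : \bar R :=
  ereal_sup [set T | (0 < T)%E /\ uniquely_solvable beta u0 psi0 T].

Definition finite_time_singularity (R : realType) (beta : R)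
    (u0 psi0 : R -> R -> R) : Prop :=
  (lifespan beta u0 psi0 < +oo)%E /\
  ~ exists u psi, solution beta u0 psi0 +oo%E u psi.

(** * The data of the blow-up criterion *)

Definition cosh (R : realType) (x : R) : R := (expR x + expR (- x)) / 2.

Definition S_exterior (R : realType) : set R :=
  [set beta | 0 < beta /\
    forall k : nat, (0 < k)%N ->
      beta !=
        k%:R * (\int[@lebesgue_measure R]_(x in `[0%R, +oo[)
                  (expR (- k%:R * cosh x) * cosh x ^+ 2)) /
        (\int[@lebesgue_measure R]_(x in `[0%R, +oo[)
           (expR (- k%:R * cosh x) * cosh x))].

(* Integral over 0 <= z <= 1, r >= 1 against r^3 dr dz. If the Lebesgue
   integral is not finite the value is 0, so a positive value is genuine. *)
Definition wint (R : realType) (f : R -> R -> R) : R :=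
  \int[(@lebesgue_measure R \x @lebesgue_measure R)%E]_(p in
      r_dom R `*` z_dom R) (f p.1 p.2 * p.1 ^+ 3).

Definition phi (R : realType) (alpha r z : R) : R :=
  expR (- alpha * r ^+ 2) * sin (pi * z).

Definition Phi (R : realType) (alpha : R) : R -> R -> R :=
  laplace5 (phi alpha).

Definition c0 (R : realType) (alpha : R) : R :=
  3 / (2 * pi ^+ 2) *
  wint (fun r z => (4 * alpha ^+ 2 * r ^+ 2 - (8 * alpha + pi ^+ 2)) ^+ 2
                   * phi alpha r z).

(* Main.v *)
(* For a weight of the form phi = theta(r) sin(pi z), put
   a(t) = int (Delta phi) log(u^2) and b(t) = int (Delta phi) psi_z.
   The first equation gives a' = 4 b.  If theta satisfies the same Robin
   condition as psi, two integrations by parts give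
   b = pi int omega theta cos(pi z), hence b' = pi^2 int u^2 phi, and
   log(u^2) <= 2 |u| with Cauchy-Schwarz gives b' >= kappa a^2 as soon as
   Delta phi >= 0; then a blows up in a time controlled by a(0) and b(0).

   On the unbounded domain this would need decay of psi and u.  It is avoided by
   replacing exp(- alpha r^2) with exp(- alpha r^2) (1 - (eps (r - 1))^3)^4,
   cut off at r = 1 + 1/eps: it keeps the Robin condition at r = 1, vanishes to
   order 4 at the outer end, and its Laplacian is still nonnegative, because
   the hypothesis on beta makes 4 alpha^2 r^2 - (8 alpha + pi^2) at least
   32 (r - 1), which dominates the error O(eps^2 (r - 1)).  The differential
   inequalities are thus exact on a bounded rectangle, where classical
   regularity suffices.  Dominated convergence, at the initial time only, gives
   an eps for which a(0) and b(0) are positive; the resulting time bound depends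
   on the data alone. *)
Require Import Defs.
From mathcomp Require Import all_boot all_order all_algebra.
From mathcomp Require Import all_classical all_reals all_analysis.
From mathcomp Require Import measurable_realfun.
From mathcomp Require Import ring lra.
Set Implicit Arguments.
Unset Strict Implicit.
Unset Printing Implicit Defensive.
Import Order.TTheory GRing.Theory Num.Theory.
Import numFieldNormedType.Exports.
Local Open Scope classical_set_scope.
Local Open Scope ring_scope.

(** * Continuity of real expressions *)

Section ContinuousReal.
Context {R : realType} {T : topologicalType}.
Implicit Types f g : T -> R.

Lemma cont_cst (c : R) : continuous (fun _ : T => c).
Proof. exact: cst_continuous. Qed.

Lemma cont_add f g : continuous f -> continuous g ->
  continuous (fun x => f x + g x).
Proof. by move=> cf cg x; exact: (cvgD (cf x) (cg x)). Qed.

Lemma cont_opp f : continuous f -> continuous (fun x => - f x).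
Proof. by move=> cf x; exact: (cvgN (cf x)). Qed.

Lemma cont_mul f g : continuous f -> continuous g ->
  continuous (fun x => f x * g x).
Proof. by move=> cf cg x; exact: (cvgM (cf x) (cg x)). Qed.

Lemma cont_inv f : (forall x, f x != 0) -> continuous f ->
  continuous (fun x => (f x)^-1).
Proof. by move=> f0 cf x; exact: (cvgV (f0 x) (cf x)). Qed.

Lemma cont_comp (h : R -> R) f : continuous h -> continuous f ->
  continuous (fun x => h (f x)).
Proof. by move=> ch cf x; exact: (continuous_comp (cf x) (ch (f x))). Qed.

Lemma cont_exp f n : continuous f -> continuous (fun x => f x ^+ n).
Proof.
by move=> cf; apply: (cont_comp (h := (fun y => y ^+ n))) => //; exact: exprn_continuous.
Qed.

Lemma cont_max f g : continuous f -> continuous g ->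
  continuous (fun x => Num.max (f x) (g x)).
Proof. by move=> cf cg x; exact: (continuous_max (cf x) (cg x)). Qed.

Lemma cont_min f g : continuous f -> continuous g ->
  continuous (fun x => Num.min (f x) (g x)).
Proof. by move=> cf cg x; exact: (continuous_min (cf x) (cg x)). Qed.

Lemma cont_expR f : continuous f -> continuous (fun x => expR (f x)).
Proof. by move=> cf; apply: (cont_comp (h := expR)) => //; exact: continuous_expR. Qed.

Lemma cont_sin f : continuous f -> continuous (fun x => sin (f x)).
Proof. by move=> cf; apply: (cont_comp (h := (@sin R))) => //; exact: continuous_sin. Qed.

Lemma cont_cos f : continuous f -> continuous (fun x => cos (f x)).
Proof. by move=> cf; apply: (cont_comp (h := (@cos R))) => //; exact: continuous_cos. Qed.

Lemma cont_sqrt f : continuous f -> continuous (fun x => Num.sqrt (f x)).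
Proof. by move=> cf; apply: (cont_comp (h := Num.sqrt)) => //; exact: sqrt_continuous. Qed.

Lemma cont_norm f : continuous f -> continuous (fun x => `|f x|).
Proof. by move=> cf x; exact: (cvg_norm (cf x)). Qed.

End ContinuousReal.

Lemma cont_id (R : realType) : continuous (fun x : R => x).
Proof. by move=> x; exact: cvg_id. Qed.

Section ContinuousProjections.
Context {R : realType} {T : topologicalType}.

Lemma cont_fst : continuous (fun p : R * T => p.1).
Proof. by move=> p; exact: cvg_fst. Qed.

Lemma cont_snd : continuous (fun p : T * R => p.2).
Proof. by move=> p; exact: cvg_snd. Qed.

Lemma cont_fst_fst : continuous (fun p : R * R * T => p.1.1).
Proof.
move=> p; have h1 : {for p, continuous (@fst (R * R) T)} by exact: cvg_fst.
have h2 : {for p.1, continuous (@fst R R)} by exact: cvg_fst.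
exact: (continuous_comp h1 h2).
Qed.

Lemma cont_snd_fst : continuous (fun p : R * R * T => p.1.2).
Proof.
move=> p; have h1 : {for p, continuous (@fst (R * R) T)} by exact: cvg_fst.
have h2 : {for p.1, continuous (@snd R R)} by exact: cvg_snd.
exact: (continuous_comp h1 h2).
Qed.

End ContinuousProjections.

Definition joint_continuous (R : realType) (f : R -> R -> R -> R) : Prop :=
  continuous (fun p : R * R * R => f p.1.1 p.1.2 p.2).

Lemma cont_triple (R : realType) (T : topologicalType) (f : R -> R -> R -> R)
    (g h k : T -> R) : joint_continuous f ->
  continuous g -> continuous h -> continuous k ->
  continuous (fun x => f (g x) (h x) (k x)).
Proof.
move=> cf cg ch ck x.
have gh : (g y, h y) @[y --> x] --> (g x, h x).
  exact: (cvg_pair (cg x) (ch x)).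
have ghk : (g y, h y, k y) @[y --> x] --> (g x, h x, k x).
  exact: (cvg_pair gh (ck x)).
exact: (cvg_comp _ _ ghk (cf (g x, h x, k x))).
Qed.

(* A head-constant alias of [continuous], on which [solve_cont] can match. *)
Definition cts (R : realType) (T : topologicalType) (f : T -> R) : Prop :=
  continuous f.

Lemma ctsP (R : realType) (T : topologicalType) (f : T -> R) :
  cts f -> continuous f.
Proof. by []. Qed.

Ltac cts_step :=
  lazymatch goal with
  | |- cts (fun _ => ?c) => exact (@cont_cst _ _ c)
  | |- cts (fun x => x) => exact (@cont_id _)
  | |- cts (fun p => p.1) => exact (@cont_fst _ _)
  | |- cts (fun p => p.2) => exact (@cont_snd _ _)
  | |- cts (fun p => p.1.1) => exact (@cont_fst_fst _ _)
  | |- cts (fun p => p.1.2) => exact (@cont_snd_fst _ _)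
  | |- cts (fun x => @?f x + @?g x) => refine (@cont_add _ _ f g _ _); apply: ctsP
  | |- cts (fun x => - @?f x) => refine (@cont_opp _ _ f _); apply: ctsP
  | |- cts (fun x => @?f x * @?g x) => refine (@cont_mul _ _ f g _ _); apply: ctsP
  | |- cts (fun x => @?f x ^+ ?n) => refine (@cont_exp _ _ f n _); apply: ctsP
  | |- cts (fun x => expR (@?f x)) => refine (@cont_expR _ _ f _); apply: ctsP
  | |- cts (fun x => sin (@?f x)) => refine (@cont_sin _ _ f _); apply: ctsP
  | |- cts (fun x => cos (@?f x)) => refine (@cont_cos _ _ f _); apply: ctsP
  | |- cts (fun x => Num.sqrt (@?f x)) => refine (@cont_sqrt _ _ f _); apply: ctsP
  | |- cts (fun x => Num.max (@?f x) (@?g x)) => refine (@cont_max _ _ f g _ _); apply: ctsP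
  | |- cts (fun x => Num.min (@?f x) (@?g x)) => refine (@cont_min _ _ f g _ _); apply: ctsP
  | |- cts (fun x => `|@?f x|) => refine (@cont_norm _ _ f _); apply: ctsP
  | H : continuous ?f |- cts (fun x => ?f (@?g x)) => refine (@cont_comp _ _ f g H _); apply: ctsP
  | H : joint_continuous ?f |- cts (fun x => ?f (@?g x) (@?h x) (@?k x)) =>
      refine (@cont_triple _ _ f g h k H _ _ _); apply: ctsP
  | _ => assumption
  end.

Ltac solve_cont := apply: ctsP; repeat cts_step.

(** * Differential inequalities *)

(** Mean value theorem. Derivatives are asked only inside the interval, because at the ends of the
    time interval the extended functions need not be differentiable; continuity carries the
    inequality there. *)
Lemma derive_ge0_le (R : realType) (f df : R -> R) (a b : R) :
  continuous f ->
  (forall t, a < t < b -> is_derive t 1 f (df t)) ->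
  (forall t, a < t < b -> 0 <= df t) ->
  forall s t, a <= s -> s <= t -> t <= b -> f s <= f t.
Proof.
move=> cf fdf df0 s t as_ st tb.
move: st; rewrite le_eqVlt => /predU1P[->//|st].
have stab x : x \in `]s, t[ -> a < x < b.
  by rewrite in_itv/= => /andP[sx xt]; rewrite (le_lt_trans as_ sx) (lt_le_trans xt tb).
have [x xst fE] := @MVT _ f df s t st (fun x h => fdf x (stab x h))
  (continuous_subspaceT cf).
by rewrite -subr_ge0 fE mulr_ge0 ?subr_ge0 ?(ltW st)// df0// stab.
Qed.

(** Gronwall for the square: [v t ^+ 2 * expR (k * t)] has derivative [2 * c + k] times itself, so
    it is nondecreasing for [k = 2 * M] and nonincreasing for [k = - (2 * M)]. *)
Lemma linear_ode_sqr_bounds (R : realType) (v c : R -> R) (tau M : R) :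
  continuous v ->
  (forall t, 0 < t < tau -> is_derive t 1 v (c t * v t)) ->
  (forall t, 0 < t < tau -> `|c t| <= M) ->
  forall t, 0 <= t <= tau ->
  v 0 ^+ 2 * expR (- (2 * M) * t) <= v t ^+ 2 <= v 0 ^+ 2 * expR (2 * M * t).
Proof.
move=> cv vc cM t /andP[t0 tt].
have ce (k : R) : continuous (fun t => v t ^+ 2 * expR (k * t)).
  by solve_cont.
have de (k s : R) : 0 < s < tau ->
    is_derive s 1 (fun t => v t ^+ 2 * expR (k * t))
      ((2 * c s + k) * (v s ^+ 2 * expR (k * s))).
  move=> hs; have h1 := vc _ hs.
  have h2 : is_derive s 1 (fun t : R => k * t) k.
    apply: is_derive_eq; by rewrite /GRing.scale/= mulr1.
  have h3 : is_derive s 1 (fun t => expR (k * t)) (expR (k * s) * k).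
    exact: (@is_derive1_comp _ expR (fun t : R => k * t)).
  apply: is_derive_eq; rewrite /GRing.scale/=; ring.
apply/andP; split.
- have := @derive_ge0_le _ _ _ 0 tau (ce (2 * M)) (de (2 * M)).
  move=> /(_ _ 0 t (lexx _) t0 tt).
  rewrite mulr0 expR0 mulr1 mulNr expRN => h.
  rewrite ler_pdivrMr ?expR_gt0//; apply: h => s hs.
  rewrite mulr_ge0 ?(mulr_ge0 (sqr_ge0 _) (expR_ge0 _))//.
  have := cM _ hs; rewrite ler_norml => /andP[h _]; lra.
- have := @derive_ge0_le _ (fun t => - (v t ^+ 2 * expR (- (2 * M) * t)))
    (fun s => - ((2 * c s + (- (2 * M))) * (v s ^+ 2 * expR (- (2 * M) * s)))) 0 tau.
  move=> /(_ (cont_opp (ce (- (2 * M))))).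
  move=> /(_ (fun s hs => is_deriveN (de (- (2 * M)) s hs))).
  move=> /(_ _ 0 t (lexx _) t0 tt) h.
  have {}h : - v 0 ^+ 2 <= - (v t ^+ 2 / expR (2 * M * t)).
    have e0 : v 0 ^+ 2 * expR (- (2 * M) * 0) = v 0 ^+ 2.
      by rewrite mulr0 expR0 mulr1.
    have et : v t ^+ 2 * expR (- (2 * M) * t) = v t ^+ 2 / expR (2 * M * t).
      by rewrite mulNr expRN.
    rewrite -e0 -et. apply: h => s hs.
    rewrite -mulNr mulr_ge0 ?(mulr_ge0 (sqr_ge0 _) (expR_ge0 _))//.
    have := cM _ hs; rewrite ler_norml => /andP[_ h]; lra.
  rewrite -ler_pdivrMr ?expR_gt0//; lra.
Qed.

Lemma is_derive_ln_sqr (R : realType) (v : R -> R) (t c : R) :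
  v t != 0 -> is_derive t 1 v (c * v t) ->
  is_derive t 1 (fun s => ln (v s ^+ 2)) (2 * c).
Proof.
move=> v0 dv.
have v2 : 0 < v t ^+ 2 by rewrite exprn_even_gt0.
have d2 : is_derive t 1 (fun s => v s ^+ 2) (2 * c * v t ^+ 2).
  apply: is_derive_eq; rewrite /GRing.scale/=; ring.
have d1 := is_derive1_ln v2.
have := @is_derive1_comp _ (@ln R) (fun s => v s ^+ 2) t _ _ d1 d2.
move/is_derive_eq; apply; field.
exact: v0.
Qed.

(* With [c ^+ 2 <= kap / 6] the quantity [b ^+ 2 - c ^+ 2 * a ^+ 3] is
   nondecreasing, so [b >= c a ^ (3/2)] persists and [a ^ (-1/2)] decreases at
   least at speed [2 c]. *)
Lemma quadratic_ode_time_bound (R : realType) (a b e : R -> R) (tau kap c : R) :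
  0 < tau -> 0 < c -> continuous a -> continuous b ->
  (forall t, 0 < t < tau -> is_derive t 1 a (4 * b t)) ->
  (forall t, 0 < t < tau -> is_derive t 1 b (e t)) ->
  (forall t, 0 < t < tau -> 0 <= e t) ->
  (forall t, 0 < t < tau -> 0 < a t -> kap * a t ^+ 2 <= e t) ->
  0 < a 0 -> 0 < b 0 -> 6 * c ^+ 2 <= kap -> c ^+ 2 * a 0 ^+ 3 <= b 0 ^+ 2 ->
  tau <= (2 * c * Num.sqrt (a 0))^-1.
Proof.
move=> tau0 c0 ca cb da db e0 ea a0 b0 ck cab.
have bge t : 0 <= t <= tau -> b 0 <= b t.
  by move=> /andP[t0 tt]; apply: (derive_ge0_le cb db e0).
have bgt t : 0 <= t <= tau -> 0 < b t.
  by move=> h; exact: lt_le_trans b0 (bge _ h).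
have age t : 0 <= t <= tau -> a 0 <= a t.
  move=> /andP[t0 tt]; apply: (derive_ge0_le ca da) => // s /andP[s0 st].
  by rewrite mulr_ge0// ltW// bgt// !ltW.
have agt t : 0 <= t <= tau -> 0 < a t.
  by move=> h; exact: lt_le_trans a0 (age _ h).
have hcmp t : 0 <= t <= tau -> c ^+ 2 * a t ^+ 3 <= b t ^+ 2.
  move=> /andP[t0 tt].
  have := @derive_ge0_le _ (fun s => b s ^+ 2 - c ^+ 2 * a s ^+ 3)
    (fun s => 2 * b s * e s - c ^+ 2 * (3 * a s ^+ 2 * (4 * b s))) 0 tau.
  move=> /(_ _ _ _ 0 t (lexx _) t0 tt) h.
  suff : b 0 ^+ 2 - c ^+ 2 * a 0 ^+ 3 <= b t ^+ 2 - c ^+ 2 * a t ^+ 3 by lra.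
  apply: h.
  - by solve_cont.
  - move=> s hs; have ha := da _ hs; have hb := db _ hs.
    apply: is_derive_eq; rewrite /GRing.scale/=; ring.
  - move=> s /andP[s0 st]; have hs : 0 <= s <= tau by rewrite !ltW.
    have h1 := ea s; rewrite s0 st in h1; have {}h1 := h1 isT (agt _ hs).
    have h2 := bgt _ hs.
    have h3 : 0 <= (kap - 6 * c ^+ 2) * a s ^+ 2.
      by rewrite mulr_ge0 ?sqr_ge0// subr_ge0.
    (* Half of the derivative to be shown nonnegative, with [kap * a s ^+ 2] subtracted and
       added. *)
    have h4 : 0 <= b s * ((e s - kap * a s ^+ 2) + (kap - 6 * c ^+ 2) * a s ^+ 2).
      by apply: mulr_ge0; [exact: ltW|apply: addr_ge0 => //; rewrite subr_ge0].
    lra.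
pose y t := (Num.sqrt (a t))^-1.
have ygt t : 0 <= t <= tau -> 0 < y t.
  by move=> h; rewrite invr_gt0 sqrtr_gt0 agt.
pose clamped_a t := Num.max (a t) (a 0).
have caE t : 0 <= t <= tau -> a t = clamped_a t.
  by move=> h; rewrite /clamped_a; apply/esym/max_idPl/age.
(* The square root of [hcmp], since [a ^+ 3] is the square of [a * Num.sqrt a]. *)
have sq_ge t : 0 <= t <= tau -> c <= b t / (a t * Num.sqrt (a t)).
  move=> h; have h1 := hcmp _ h; have h2 := agt _ h.
  rewrite ler_pdivlMr ?mulr_gt0 ?sqrtr_gt0//.
  rewrite -(ler_pXn2r (n := 2)) ?nnegrE//; last 2 first.
    by rewrite !mulr_ge0 ?sqrtr_ge0// ltW.
    by rewrite ltW// bgt.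
  rewrite !exprMn sqr_sqrtr ?(ltW h2)//.
  by rewrite -exprSr.
have sgt t : 0 <= t <= tau -> 0 < Num.sqrt (a t) by move=> h; rewrite sqrtr_gt0 agt.
(* [clamped_a] keeps the inverse square root continuous on all of R *)
have := @derive_ge0_le _ (fun t => - (Num.sqrt (clamped_a t))^-1 - 2 * c * t)
  (fun t => 2 * (b t / (a t * Num.sqrt (a t))) - 2 * c) 0 tau.
have clamped_a_gt0 t : 0 < clamped_a t by rewrite /clamped_a lt_max a0 orbT.
move=> /(_ _ _ _ 0 tau (lexx _) (ltW tau0) (lexx _)) h.
have hz : 0 <= (0 : R) <= tau by apply/andP; split => //; exact: ltW.
have ht : 0 <= tau <= tau by apply/andP; split => //; exact: ltW.
have {h} : - y 0 <= - y tau - 2 * c * tau.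
  rewrite /y (caE 0)// (caE tau)//.
  rewrite mulr0 subr0 in h; apply: h.
  - apply: cont_add; last by solve_cont.
    apply: cont_opp; apply: cont_inv; last by rewrite /clamped_a; solve_cont.
    by move=> x; rewrite gt_eqF// sqrtr_gt0.
  - move=> s hs; have ha := da _ hs.
    have hs' : 0 <= s <= tau by move/andP: hs => [? ?]; rewrite !ltW.
    apply: (@near_eq_is_derive _ _ _ (fun t => - (Num.sqrt (a t))^-1 - 2 * c * t)).
      have : \near s, 0 < s < tau.
        have := @near_in_itvoo R 0 tau s; rewrite in_itv/= => /(_ hs).
        by apply: filterS => x; rewrite in_itv.
      apply: filterS => x /andP[x0 xt]; rewrite -caE//.
      by rewrite !ltW.
    have d1 := is_derive1_sqrt (agt _ hs').
    have d2 := @is_derive1_comp _ Num.sqrt a s _ _ d1 ha.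
    have d3 := @is_deriveV _ (Num.sqrt \o a) s _ _ (lt0r_neq0 (sgt _ hs')) d2.
    have d4 : is_derive s 1 (fun t : R => 2 * c * t) (2 * c).
      apply: is_derive_eq; by rewrite /GRing.scale/= mulr1.
    have := is_deriveB (is_deriveN d3) d4.
    move/is_derive_eq; apply.
    have : Num.sqrt (a s) ^+ 2 = a s by rewrite sqr_sqrtr// ltW// agt.
    have : Num.sqrt (a s) != 0 by rewrite lt0r_neq0// sgt.
    rewrite /GRing.scale/=; set w := Num.sqrt (a s) => w0 <-; field.
    exact: w0.
  - move=> s /andP[s0 st]; have hs : 0 <= s <= tau by rewrite !ltW.
    have := sq_ge _ hs; lra.
(* As [y tau] is positive, the total decrease [2 * c * tau] is less than [y 0]. *)
have := ygt _ ht => y1 y2.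
have : 2 * c * tau <= y 0 by lra.
rewrite invfM -/(y 0) mulrC -ler_pdivlMr ?mulr_gt0//.
by rewrite mulrC.
Qed.

(** * Integrals over rectangles *)

Section PlaneIntegral.
Context {R : realType}.
Local Notation mu := (@lebesgue_measure R).
Local Notation mu2 := (@lebesgue_measure R \x @lebesgue_measure R)%E.
Local Notation RR := (measurableTypeR R * measurableTypeR R)%type.

(** The product sigma-algebra contains all boxes, and an open set is the union of the countably many
    boxes with rational corners that it contains. *)
Lemma open_measurable_plane (U : set (R * R)) :
  open U -> measurable (U : set RR).
Proof.
move=> oU.
pose box (q : (rat * rat) * (rat * rat)) : set (R * R) :=
  `]ratr q.1.1, ratr q.1.2[%classic `*` `]ratr q.2.1, ratr q.2.2[%classic.
(* Boxes not contained in [U] are replaced by the empty set, so that the union can run over all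
   rational quadruples. *)
pose F q : set (R * R) := if `[< box q `<=` U >] then box q else set0.
have -> : U = \bigcup_q F q.
  apply/seteqP; split => [[x y] Uxy|x [q _]]; last first.
    by rewrite /F; case: asboolP => // h /h.
  move: oU; rewrite openE => /(_ _ Uxy); rewrite /interior.
  move=> [/= [A B]] [/= /nbhs_ballP[e1 /= e10 e1A] /nbhs_ballP[e2 /= e20 e2B]] AB.
  have h1 : x - e1 < x by rewrite ltrBlDr ltrDl.
  have h2 : x < x + e1 by rewrite ltrDl.
  have h3 : y - e2 < y by rewrite ltrBlDr ltrDl.
  have h4 : y < y + e2 by rewrite ltrDl.
  have [a] := rat_in_itvoo h1; rewrite in_itv/= => /andP[a1 a2].
  have [b] := rat_in_itvoo h2; rewrite in_itv/= => /andP[b1 b2].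
  have [c] := rat_in_itvoo h3; rewrite in_itv/= => /andP[c1 c2].
  have [d] := rat_in_itvoo h4; rewrite in_itv/= => /andP[d1 d2].
  exists ((a, b), (c, d)) => //; rewrite /F.
  case: asboolP => [_|]; first by split => /=; rewrite in_itv/= ?a2 ?b1 ?c2 ?d1.
  case=> -[x' y'] [/=]; rewrite !in_itv/= => /andP[ax xb] /andP[cy yd].
  apply: AB; split => /=.
    by apply: e1A; rewrite /ball/= ltr_distlC; apply/andP; split; lra.
  by apply: e2B; rewrite /ball/= ltr_distlC; apply/andP; split; lra.
apply: countable_bigcupT_measurable => [|q]; first exact: countableP.
rewrite /F; case: ifP => _ //; exact: measurableX.
Qed.

Lemma continuous_measurable_plane (f : R * R -> R) :
  continuous f -> measurable_fun setT (f : RR -> measurableTypeR R).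
Proof.
move=> /continuousP cf; apply: (measurability _ (measurable_realfun.RGenOpens.measurableE R)).
move=> _ [_ [a [b ->] <-]]; rewrite setTI; apply: open_measurable_plane.
exact/cf/interval_open.
Qed.

Definition rect (a b c d : R) : set (R * R) :=
  `[a, b]%classic `*` `[c, d]%classic.

Lemma measurable_rect a b c d : measurable (rect a b c d : set RR).
Proof. exact: measurableX. Qed.

Lemma rect_finite a b c d : (mu2 (rect a b c d) < +oo)%E.
Proof.
have mu_fin x y : (mu `[x, y] < +oo)%E.
  by apply: compact_finite_measure; exact: segment_compact.
rewrite product_measure1E//; apply: lte_mul_pinfty => //; last exact: mu_fin.
by apply/fin_numPlt; rewrite (lt_le_trans _ (measure_ge0 _ _)) ?ltNye//; exact: mu_fin.
Qed.

Lemma rect_integrable a b c d (f : R * R -> R) : continuous f ->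
  mu2.-integrable (rect a b c d) (EFin \o f).
Proof.
move=> cf; apply: measurable_bounded_integrable.
- exact: measurable_rect.
- exact: rect_finite.
- by apply: measurable_funTS; exact: continuous_measurable_plane.
- have cK : compact (rect a b c d).
    exact: (compact_setX (@segment_compact R a b) (@segment_compact R c d)).
  have /compact_bounded[M [_ mrt]] :=
    continuous_compact (continuous_subspaceT cf) cK.
  by exists M; split; rewrite ?num_real // => ? ? ? ?; exact: mrt.
Qed.

Lemma rect_restrict_integrable a b c d (f : R * R -> R) : continuous f ->
  mu2.-integrable setT ((EFin \o f) \_ (rect a b c d)).
Proof.
move=> cf; apply/(integrable_mkcond _ (measurable_rect a b c d)).1.
exact: rect_integrable.
Qed.

(** Fubini on the whole plane, applied to the extension of [f] by zero; for [x] outside [[a, b]] the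
    inner integral vanishes. *)
Lemma integral_rect12 a b c d (f : R * R -> R) : continuous f ->
  (\int[mu2]_(p in rect a b c d) (f p)%:E =
   \int[mu]_(x in `[a, b]) \int[mu]_(y in `[c, d]) (f (x, y))%:E)%E.
Proof.
move=> cf; rewrite integral_mkcond.
rewrite -(integral12_prod_meas1 (rect_restrict_integrable a b c d cf)).
rewrite [RHS]integral_mkcond; apply: eq_integral => x _.
rewrite /fubini_F patchE; case: ifPn => xab.
  rewrite [RHS]integral_mkcond; apply: eq_integral => y _.
  rewrite !patchE; congr (if _ then _ else _).
  by rewrite /rect in_setX/= xab.
by rewrite integral0_eq// => y _; rewrite patchE in_setX/= (negbTE xab).
Qed.

Lemma integral_rect21 a b c d (f : R * R -> R) : continuous f ->
  (\int[mu2]_(p in rect a b c d) (f p)%:E =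
   \int[mu]_(y in `[c, d]) \int[mu]_(x in `[a, b]) (f (x, y))%:E)%E.
Proof.
move=> cf; rewrite integral_mkcond.
rewrite -(integral21_prod_meas1 (rect_restrict_integrable a b c d cf)).
rewrite [RHS]integral_mkcond; apply: eq_integral => y _.
rewrite /fubini_G patchE; case: ifPn => ycd.
  rewrite [RHS]integral_mkcond; apply: eq_integral => x _.
  rewrite !patchE; congr (if _ then _ else _).
  by rewrite /rect in_setX/= ycd andbT.
by rewrite integral0_eq// => x _; rewrite patchE in_setX/= (negbTE ycd) andbF.
Qed.

Lemma segment_integrable a b (f : R -> R) : continuous f ->
  mu.-integrable `[a, b] (EFin \o f).
Proof.
move=> cf; apply: continuous_compact_integrable; first exact: segment_compact.
exact: continuous_subspaceT.
Qed.

Lemma integral_segment_fin_num a b (f : R -> R) : continuous f ->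
  (\int[mu]_(x in `[a, b]) (f x)%:E \is a fin_num)%E.
Proof.
move=> cf; have mab : measurable (`[a, b]%classic : set (measurableTypeR R)) by [].
exact: (integrable_fin_num mab (segment_integrable a b cf)).
Qed.

Lemma cont_pair (T : topologicalType) (f : R * R -> R) (g h : T -> R) :
  continuous f -> continuous g -> continuous h -> continuous (fun x => f (g x, h x)).
Proof.
move=> cf cg ch x.
have gh : (g y, h y) @[y --> x] --> (g x, h x).
  exact: (cvg_pair (cg x) (ch x)).
exact: (cvg_comp _ _ gh (cf (g x, h x))).
Qed.

Lemma cont_pairl (f : R * R -> R) x : continuous f -> continuous (fun y => f (x, y)).
Proof. by move=> cf; apply: cont_pair => //; [exact: cont_cst|exact: cont_id]. Qed.

Lemma cont_pairr (f : R * R -> R) y : continuous f -> continuous (fun x => f (x, y)).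
Proof. by move=> cf; apply: cont_pair => //; [exact: cont_id|exact: cont_cst]. Qed.

(** Brings an integration by parts performed at each fixed [x] under the plane integral. *)
Lemma eq_rect_integral_inner_snd a b c d (f g : R * R -> R) :
  continuous f -> continuous g ->
  (forall x, a <= x <= b ->
    \int[mu]_(y in `[c, d]) f (x, y) = \int[mu]_(y in `[c, d]) g (x, y)) ->
  \int[mu2]_(p in rect a b c d) f p = \int[mu2]_(p in rect a b c d) g p.
Proof.
move=> cf cg fg; rewrite /Rintegral; congr fine.
rewrite !integral_rect12//; apply: eq_integral => x; rewrite inE/= in_itv/= => xab.
have := fg x xab; rewrite /Rintegral => /(congr1 (@EFin R)).
by rewrite !fineK//; apply: integral_segment_fin_num; exact: cont_pairl.
Qed.

Lemma eq_rect_integral_inner_fst a b c d (f g : R * R -> R) :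
  continuous f -> continuous g ->
  (forall y, c <= y <= d ->
    \int[mu]_(x in `[a, b]) f (x, y) = \int[mu]_(x in `[a, b]) g (x, y)) ->
  \int[mu2]_(p in rect a b c d) f p = \int[mu2]_(p in rect a b c d) g p.
Proof.
move=> cf cg fg; rewrite /Rintegral; congr fine.
rewrite !integral_rect21//; apply: eq_integral => y; rewrite inE/= in_itv/= => ycd.
have := fg y ycd; rewrite /Rintegral => /(congr1 (@EFin R)).
by rewrite !fineK//; apply: integral_segment_fin_num; exact: cont_pairr.
Qed.

(** Continuity on all of R supplies the one-sided limits at [a] and [b], so that derivatives are
    used only in the interior. *)
Lemma segment_by_parts (a b : R) (f g df dg : R -> R) : a < b ->
  continuous f -> continuous g -> continuous df -> continuous dg ->
  (forall x, a < x < b -> is_derive x 1 f (df x)) ->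
  (forall x, a < x < b -> is_derive x 1 g (dg x)) ->
  \int[mu]_(x in `[a, b]) (f x * dg x) =
  f b * g b - f a * g a - \int[mu]_(x in `[a, b]) (df x * g x).
Proof.
move=> ab cf cg cdf cdg fdf gdg.
have oo (h dh : R -> R) : continuous h ->
    (forall x, a < x < b -> is_derive x 1 h (dh x)) ->
    derivable_oo_LRcontinuous h a b /\ {in `]a, b[, derive1 h =1 dh}.
  move=> ch hdh; split; last first.
    by move=> x; rewrite in_itv/= => /hdh [_ <-]; rewrite derive1E.
  split; last 2 first.
  - exact: (cvg_at_right_filter (ch a)).
  - exact: (cvg_at_left_filter (ch b)).
  - by move=> x; rewrite in_itv/= => /hdh[].
have [f1 f2] := oo _ _ cf fdf; have [g1 g2] := oo _ _ cg gdg.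
by apply: Rintegration_by_parts => //; exact: continuous_subspaceT.
Qed.

End PlaneIntegral.

(** * Continuity and differentiation in time of integrals over a rectangle *)

Section ParameterIntegral.
Context {R : realType}.
Local Notation mu2 := (@lebesgue_measure R \x @lebesgue_measure R)%E.
Variables (N tau : R).
Local Notation K := (rect 1 N 0 1 : set (measurableTypeR R * measurableTypeR R)).

Lemma cont_rect_integral (F : R -> R * R -> R) (G : R * R -> R) :
  (forall t, mu2.-integrable K (EFin \o F t)) ->
  (forall p, K p -> continuous (fun t => F t p)) ->
  mu2.-integrable K (EFin \o G) ->
  (forall t p, K p -> `|F t p| <= G p) ->
  continuous (fun t => \int[mu2]_(p in K) F t p).
Proof.
move=> iF cF iG FG t.
have := @continuity_under_integral R _ _ mu2 F K (measurable_rect _ _ _ _) (t - 1) (t + 1).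
move=> /(_ (fun t _ => iF t)); apply; last by rewrite inE/= in_itv/= gtrBl ltrDl ltr01.
- by apply: aeW => p Kp s _; exact: cF.
- exact: iG.
- by move=> s _; apply: aeW => p Kp; exact: FG.
Qed.

Lemma is_derive_rect_integral (F dF : R -> R * R -> R) (M : R) :
  (forall t, mu2.-integrable K (EFin \o F t)) ->
  (forall t p, 0 < t < tau -> K p -> is_derive t 1 (fun t => F t p) (dF t p)) ->
  (forall t p, 0 < t < tau -> K p -> `|dF t p| <= M) ->
  forall t, 0 < t < tau ->
  is_derive t 1 (fun t => \int[mu2]_(p in K) F t p) (\int[mu2]_(p in K) dF t p).
Proof.
move=> iF dFE FM t ht.
(* The dominating function has to be nonnegative, and the sign of [M] is not given. *)
have M'0 : 0 <= Num.max M 0 by rewrite le_max lexx orbT.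
have It : t \in `]0, tau[ by rewrite in_itv.
have dF1 s p : `]0, tau[%classic s -> K p -> derivable (F ^~ p) s 1.
  by rewrite /= in_itv/= => hs Kp; have [] := dFE s p hs Kp.
have iM : mu2.-integrable K (EFin \o (fun=> Num.max M 0)).
  by apply: rect_integrable; exact: cont_cst.
have ub s p : `]0, tau[%classic s -> K p -> `|partial1of2 F s p| <= Num.max M 0.
  rewrite /= in_itv/= => hs Kp; have [_ E] := dFE s p hs Kp.
  by rewrite partial1of2E E le_max FM.
have mK := @measurable_rect R 1 N 0 1.
split.
  exact: (derivable_under_integral mK It (fun s _ => iF s) dF1 (fun=> M'0) iM ub).
rewrite -derive1E.
rewrite (differentiation_under_integral mK It (fun s _ => iF s) dF1 (fun=> M'0) iM ub).
apply: eq_Rintegral => p; rewrite inE => Kp.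
by rewrite partial1of2E; have [_] := dFE t p ht Kp.
Qed.

End ParameterIntegral.

Lemma joint_continuous_bounded (R : realType) (f : R -> R -> R -> R) (a b N : R) :
  joint_continuous f ->
  exists M, forall t r z, a <= t <= b -> 1 <= r <= N -> 0 <= z <= 1 ->
    `|f t r z| <= M.
Proof.
move=> cf.
have cK : compact (`[a, b]%classic `*` `[1, N]%classic `*` `[0, 1]%classic : set (R * R * R)).
  exact: (compact_setX (compact_setX (@segment_compact R a b) (@segment_compact R 1 N))
   (@segment_compact R 0 1)).
have /compact_bounded[M [_ mrt]] := continuous_compact (continuous_subspaceT cf) cK.
(* Boundedness is phrased for every constant strictly above a threshold [M]. *)
exists (M + 1) => t r z ht hr hz; apply: mrt; first by rewrite ltrDl.
by exists (t, r, z).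
Qed.

(** * The truncated radial weight *)

Section Weights.
Context {R : realType}.
Variables (al eps : R).

Definition gauss (r : R) : R := expR (- al * r ^+ 2).
(** Decreases from 1 at [r = 1] to 0 at [r = 1 + 1 / eps]. The cube makes its first two derivatives
    vanish at [r = 1], so there the truncation changes neither the Robin condition nor the
    Laplacian. *)
Definition cut (r : R) : R := 1 - ((r - 1) * eps) ^+ 3.
(** The fourth power leaves a factor [cut ^+ 2] in the Laplacian, hence [weight ^+ 2 / radial]
    equals [gauss * mult ^+ 2] and stays bounded up to the outer end. *)
Definition radial (r : R) : R := cut r ^+ 4 * gauss r.
Definition radial' (r : R) : R :=
  cut r ^+ 3 * (- (2 * al * r) * cut r - 12 * eps * ((r - 1) * eps) ^+ 2) * gauss r.
(** The three lines stem from the Laplacian of the Gaussian, from the terms with the first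
    derivative of [cut ^+ 4], and from its second derivative, after the common factor
    [gauss * cut ^+ 2] is taken out. *)
Definition mult (r : R) : R :=
  r ^+ 3 * (cut r ^+ 2 * (4 * al ^+ 2 * r ^+ 2 - (8 * al + pi ^+ 2)))
  + 12 * eps * ((r - 1) * eps) ^+ 2 * cut r * (4 * al * r ^+ 4 - 3 * r ^+ 2)
  + 12 * eps ^+ 2 * ((r - 1) * eps) * (11 * ((r - 1) * eps) ^+ 3 - 2) * r ^+ 3.
(* [r ^ 3 (radial'' + (3/r) radial' - pi^2 radial)], cleared of denominators *)
Definition weight (r : R) : R := gauss r * cut r ^+ 2 * mult r.

Lemma is_derive_gauss (r : R) : is_derive r 1 gauss (- (2 * al * r) * gauss r).
Proof.
have h : is_derive r 1 (fun r : R => - al * r ^+ 2) (- (2 * al * r)).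
  apply: is_derive_eq; rewrite /GRing.scale/=; ring.
have := @is_derive1_comp _ expR (fun r : R => - al * r ^+ 2) r _ _ (is_derive_expR _) h.
by move/is_derive_eq; apply; rewrite mulrC.
Qed.

Lemma is_derive_radial (r : R) : is_derive r 1 radial (radial' r).
Proof.
have h := is_derive_gauss r.
rewrite /radial /cut; apply: is_derive_eq.
rewrite /radial' /cut /GRing.scale/=; ring.
Qed.

(** Multiplying by [r ^+ 3] puts the radial part of the five-dimensional Laplacian in divergence
    form. *)
Lemma is_derive_radial' (r : R) :
  is_derive r 1 (fun r => r ^+ 3 * radial' r) (weight r + pi ^+ 2 * (r ^+ 3 * radial r)).
Proof.
have h := is_derive_gauss r.
rewrite /radial' /cut; apply: is_derive_eq.
rewrite /weight /mult /radial /cut /GRing.scale/=; ring.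
Qed.

Lemma cont_gauss : continuous gauss.
Proof. by rewrite /gauss; solve_cont. Qed.

Lemma cont_radial : continuous radial.
Proof. by rewrite /radial /cut /gauss; solve_cont. Qed.

Lemma cont_radial' : continuous radial'.
Proof. by rewrite /radial' /cut /gauss; solve_cont. Qed.

Lemma cont_mult : continuous mult.
Proof. by rewrite /mult /cut; solve_cont. Qed.

Lemma cont_weight : continuous weight.
Proof. by rewrite /weight /mult /cut /gauss; solve_cont. Qed.

End Weights.

(** * Sign and size of the weight on the truncated domain *)

Section WeightBounds.
Context {R : realType}.
Variables (al eps : R).
Hypothesis al2 : 2 <= al.
Hypothesis alpi : 8 * al + pi ^+ 2 <= 4 * al ^+ 2.
Hypothesis eps0 : 0 < eps.
Hypothesis eps_half : eps <= 2^-1.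

Let N := 1 + eps^-1.

Lemma scaled_radius_unit r : 1 <= r <= N -> 0 <= (r - 1) * eps <= 1.
Proof.
move=> /andP[r1 rN]; apply/andP; split.
  by rewrite mulr_ge0 ?subr_ge0// ltW.
by rewrite -ler_pdivlMr// mul1r lerBlDl.
Qed.

Lemma cube_unit_interval (x : R) : 0 <= x <= 1 -> 0 <= x ^+ 3 <= 1.
Proof. by move=> /andP[x0 x1]; rewrite exprn_ge0//= exprn_ile1. Qed.

Lemma cut_ge0 r : 1 <= r <= N -> 0 <= cut eps r.
Proof. by move=> /scaled_radius_unit/cube_unit_interval/andP[_ h]; rewrite /cut subr_ge0. Qed.

Lemma cut_le1 r : 1 <= r <= N -> cut eps r <= 1.
Proof. by move=> /scaled_radius_unit/cube_unit_interval/andP[h _]; rewrite /cut lerBlDr lerDl. Qed.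

Local Notation base r := (4 * al ^+ 2 * r ^+ 2 - (8 * al + pi ^+ 2)).

(** By [alpi] the expression is nonnegative at [r = 1], so it is at least
    [4 * al ^+ 2 * (r ^+ 2 - 1)]; then [al >= 2] and [r >= 1] are inserted. The first bound is
    matched with the cross term of [mult], the second with its last term. *)
Lemma base_ge r : 1 <= r -> 8 * al * r * (r - 1) <= base r /\ 32 * (r - 1) <= base r.
Proof.
have al2' := al2; have alpi' := alpi.
move=> r1.
have h : 4 * al ^+ 2 * ((r - 1) * (r + 1)) <= base r.
  have -> : (r - 1) * (r + 1) = r ^+ 2 - 1 by ring.
  by rewrite mulrBr mulr1 lerB.
have y0 : 0 <= r - 1 by rewrite subr_ge0.
have a2 : 2 * al <= al ^+ 2 by rewrite expr2 ler_wpM2r//; lra.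
have h1 : 0 <= (al ^+ 2 - 2 * al) * ((r - 1) * (r + 1)).
  by rewrite mulr_ge0 ?subr_ge0// mulr_ge0//; lra.
have h2 : 0 <= (al - 2) * ((r - 1) * (r + 1)).
  by rewrite mulr_ge0 ?subr_ge0// mulr_ge0//; lra.
have h3 : 0 <= (r - 1) * (r - 1) by rewrite mulr_ge0.
have h4 : 0 <= al * (r - 1) by rewrite mulr_ge0//; lra.
by split; lra.
Qed.

Lemma base_ge0 r : 1 <= r -> 0 <= base r.
Proof. by move=> r1; have [_] := base_ge r1; apply: le_trans; lra. Qed.

(** The cross term is nonnegative by itself. Only the second derivative of the cut-off can be
    negative, and only near [r = 1], where the cut-off is close to 1 and the Gaussian part
    dominates. *)
Lemma mult_ge0 r : 1 <= r <= N -> 0 <= mult al eps r.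
Proof.
have al2' := al2; have e' := eps0; have e'' := eps_half.
move=> hr; have /andP[x0 x1] := scaled_radius_unit hr; have c0 := cut_ge0 hr.
have /andP[r1 _] := hr.
have [_ b32] := base_ge r1.
have b0 := base_ge0 r1.
have r0 : 0 <= r by lra.
have mid : 0 <= 12 * eps * ((r - 1) * eps) ^+ 2 * cut eps r * (4 * al * r ^+ 4 - 3 * r ^+ 2).
  have -> : 4 * al * r ^+ 4 - 3 * r ^+ 2 = r ^+ 2 * (4 * al * r ^+ 2 - 3) by ring.
  have h : 1 <= r ^+ 2 by rewrite exprn_ege1.
  have h' : 0 <= (al - 2) * r ^+ 2 by rewrite mulr_ge0 ?sqr_ge0// subr_ge0.
  have h'' : 0 <= 4 * al * r ^+ 2 - 3 by lra.
  rewrite mulr_ge0//; last by rewrite mulr_ge0 ?sqr_ge0.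
  by rewrite mulr_ge0// mulr_ge0 ?sqr_ge0// mulr_ge0// ltW.
suff : 0 <= r ^+ 3 * (cut eps r ^+ 2 * base r
    + 12 * eps ^+ 2 * ((r - 1) * eps) * (11 * ((r - 1) * eps) ^+ 3 - 2)).
  by rewrite /mult; move: mid; lra.
apply: mulr_ge0; first exact: exprn_ge0.
have [q2|q2] := leP 2 (11 * ((r - 1) * eps) ^+ 3).
  rewrite addr_ge0//; first by rewrite mulr_ge0 ?sqr_ge0.
  rewrite mulr_ge0 ?subr_ge0// mulr_ge0// mulr_ge0// sqr_ge0//.
(* With [x = (r - 1) * eps] and [11 * x ^+ 3 < 2], the cut-off is at least 9/11, so the Gaussian
   part is at least half of [base r], that is [32 * x]; the negative part is at most
   [24 * eps ^+ 2 * x <= 6 * x]. *)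
have xle : 64 * ((r - 1) * eps) <= base r.
  apply: le_trans b32.
  have : 0 <= (r - 1) * (2^-1 - eps) by rewrite mulr_ge0 ?subr_ge0.
  lra.
have c2 : 1 / 2 <= cut eps r ^+ 2.
  have c9 : 9 / 11 <= cut eps r by rewrite /cut; lra.
  have : 0 <= (cut eps r - 9 / 11) * (cut eps r + 9 / 11) by rewrite mulr_ge0; lra.
  rewrite expr2; lra.
have h1 : 0 <= (cut eps r ^+ 2 - 1 / 2) * base r by rewrite mulr_ge0// subr_ge0.
have e2 : eps ^+ 2 <= 1 / 4.
  have : 0 <= (2^-1 - eps) * (2^-1 + eps) by rewrite mulr_ge0; lra.
  rewrite expr2; lra.
have h2 : 0 <= (1 / 4 - eps ^+ 2) * ((r - 1) * eps) by rewrite mulr_ge0// subr_ge0.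
have h3 : 0 <= eps ^+ 2 * ((r - 1) * eps) * ((r - 1) * eps) ^+ 3.
  by apply: mulr_ge0; [apply: mulr_ge0 => //; exact: sqr_ge0|exact: exprn_ge0].
lra.
Qed.

(** A bound uniform in [eps], which provides the dominating function in the limit of vanishing
    [eps]. *)
Lemma mult_le r : 1 <= r <= N -> mult al eps r <= 4 * (r ^+ 3 * base r).
Proof.
have al2' := al2; have e' := eps0; have e'' := eps_half.
move=> hr; have /andP[x0 x1] := scaled_radius_unit hr; have c0 := cut_ge0 hr.
have c1 := cut_le1 hr.
have /andP[r1 _] := hr.
have [b8 b32] := base_ge r1.
have b0 := base_ge0 r1.
have r0 : 0 <= r by lra.
have y0 : 0 <= r - 1 by lra.
have e2 : eps ^+ 2 <= 1 / 4.
  have : 0 <= (2^-1 - eps) * (2^-1 + eps) by rewrite mulr_ge0; lra.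
  rewrite expr2; lra.
have h1 : cut eps r ^+ 2 * base r <= base r by rewrite ler_piMl// exprn_ile1.
have h2 : 12 * eps * ((r - 1) * eps) ^+ 2 * cut eps r * (4 * al * r ^+ 4 - 3 * r ^+ 2)
    <= r ^+ 3 * (48 * al * r * (r - 1) * eps ^+ 2).
  have -> : r ^+ 3 * (48 * al * r * (r - 1) * eps ^+ 2) =
    12 * eps * ((r - 1) * eps) * 1 * (4 * al * r ^+ 4) by ring.
  have p0 : 0 <= 12 * eps * ((r - 1) * eps) ^+ 2 * cut eps r.
    by rewrite mulr_ge0// mulr_ge0 ?sqr_ge0// mulr_ge0// ltW.
  apply: (@le_trans _ _ (12 * eps * ((r - 1) * eps) ^+ 2 * cut eps r * (4 * al * r ^+ 4))).
    by rewrite ler_wpM2l// gerBl mulr_ge0// sqr_ge0.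
  rewrite ler_wpM2r//.
    by apply: mulr_ge0; [lra|exact: exprn_ge0].
  apply: ler_pM => //; first by rewrite mulr_ge0 ?sqr_ge0// mulr_ge0// ltW.
  rewrite ler_wpM2l//; first by rewrite mulr_ge0// ltW.
  by rewrite expr2 ler_piMl.
have h3 : 12 * eps ^+ 2 * ((r - 1) * eps) * (11 * ((r - 1) * eps) ^+ 3 - 2)
    <= 108 * eps ^+ 2 * ((r - 1) * eps).
  have -> : 108 * eps ^+ 2 * ((r - 1) * eps) = 12 * eps ^+ 2 * ((r - 1) * eps) * 9 by ring.
  rewrite ler_wpM2l//; first by rewrite mulr_ge0// mulr_ge0// sqr_ge0.
  by have /andP[_] := cube_unit_interval (scaled_radius_unit hr); lra.
have r3 : 0 <= r ^+ 3 by rewrite exprn_ge0.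
have h4 : 48 * al * r * (r - 1) * eps ^+ 2 <= 6 / 4 * base r.
  have h : 0 <= al * r * (r - 1) by rewrite !mulr_ge0//; lra.
  have := mulr_ge0 h (_ : 0 <= 1 / 4 - eps ^+ 2); rewrite subr_ge0 => /(_ e2); lra.
have h5 : 108 * eps ^+ 2 * ((r - 1) * eps) <= base r.
  have h : 0 <= (1 / 4 - eps ^+ 2) * ((r - 1) * eps) by rewrite mulr_ge0// subr_ge0.
  have : 0 <= (r - 1) * (2^-1 - eps) by rewrite mulr_ge0 ?subr_ge0.
  lra.
(* The three lines of [mult] cost 1, 3/2 and 1 times [base r], together less than 4. *)
apply: (@le_trans _ _ (r ^+ 3 * (base r + 48 * al * r * (r - 1) * eps ^+ 2
   + 108 * eps ^+ 2 * ((r - 1) * eps)))); last first.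
  by rewrite [leRHS]mulrCA ler_wpM2l//; lra.
rewrite [leRHS](_ : _ = r ^+ 3 * base r + r ^+ 3 * (48 * al * r * (r - 1) * eps ^+ 2)
   + r ^+ 3 * (108 * eps ^+ 2 * ((r - 1) * eps))); last by ring.
rewrite /mult; apply: lerD; last by rewrite [leRHS]mulrC ler_wpM2r.
by apply: lerD => //; rewrite ler_wpM2l.
Qed.

End WeightBounds.

(** * Integration by parts in space *)

Section SpatialIdentity.
Context {R : realType}.
Local Notation mu := (@lebesgue_measure R).
Local Notation mu2 := (@lebesgue_measure R \x @lebesgue_measure R)%E.
Variables (al eps : R).
Hypothesis eps0 : 0 < eps.
Let N := 1 + eps^-1.
Local Notation K := (rect 1 N 0 1).
Local Notation I f := (\int[mu2]_(p in K) f p).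

Lemma ltr1N : 1 < N.
Proof. by rewrite /N ltrDl invr_gt0. Qed.

Lemma cut_last : cut eps N = 0.
Proof.
have -> : cut eps N = 1 - (N - 1) ^+ 3 * eps ^+ 3 by rewrite /cut exprMn.
by rewrite /N addrAC subrr add0r -exprMn mulVf ?lt0r_neq0// expr1n subrr.
Qed.

Lemma radial_last : radial al eps N = 0.
Proof. by rewrite /radial cut_last expr0n/= mul0r. Qed.

Lemma radial'_last : radial' al eps N = 0.
Proof. by rewrite /radial' cut_last expr0n/= !mul0r. Qed.

Lemma radial_first : radial al eps 1 = gauss al 1.
Proof. by rewrite /radial /cut subrr mul0r expr0n/= subr0 expr1n mul1r. Qed.

Lemma radial'_first : radial' al eps 1 = - (2 * al) * gauss al 1.
Proof.
by rewrite /radial' /cut subrr mul0r !expr0n/= !subr0 !expr1n !mul1r mulr0 subr0 !mulr1.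
Qed.

Lemma rect_integralD (f g : R * R -> R) : continuous f -> continuous g ->
  I (fun p => f p + g p) = I f + I g.
Proof.
by move=> cf cg; apply: RintegralD; [exact: measurable_rect|exact: rect_integrable..].
Qed.

Lemma rect_integralZ (f : R * R -> R) (c : R) : continuous f ->
  I (fun p => c * f p) = c * I f.
Proof.
by move=> cf; apply: RintegralZl; [exact: measurable_rect|exact: rect_integrable].
Qed.

Lemma is_derive_sinpi (z : R) : is_derive z 1 (fun z => sin (pi * z)) (pi * cos (pi * z)).
Proof.
have h : is_derive z 1 (fun z : R => pi * z) pi.
  by apply: is_derive_eq; rewrite /GRing.scale/= mulr1.
have := @is_derive1_comp _ (@sin R) (fun z : R => pi * z) z _ _ (is_derive_sin _) h.
by move/is_derive_eq; apply; rewrite mulrC.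
Qed.

Lemma is_derive_cospi (z : R) : is_derive z 1 (fun z => cos (pi * z)) (- pi * sin (pi * z)).
Proof.
have h : is_derive z 1 (fun z : R => pi * z) pi.
  by apply: is_derive_eq; rewrite /GRing.scale/= mulr1.
have := @is_derive1_comp _ (@cos R) (fun z : R => pi * z) z _ _ (is_derive_cos _) h.
by move/is_derive_eq; apply; rewrite mulrC mulNr mulrN.
Qed.

Lemma segment_integral_sin (P Pz : R -> R) : continuous P -> continuous Pz ->
  (forall z : R, 0 < z < 1 -> is_derive z 1 P (Pz z)) ->
  \int[mu]_(z in `[0, 1]) (sin (pi * z) * Pz z) =
  - pi * \int[mu]_(z in `[0, 1]) (cos (pi * z) * P z).
Proof.
move=> cP cPz dP.
have cs : continuous (fun z : R => sin (pi * z)) by solve_cont.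
have cc : continuous (fun z : R => pi * cos (pi * z)) by solve_cont.
have c0 : continuous (fun z : R => cos (pi * z) * P z) by solve_cont.
rewrite (segment_by_parts ltr01 cs cP cc cPz (fun z _ => is_derive_sinpi z) dP).
rewrite mulr1 mulr0 sinpi sin0 !mul0r subrr sub0r mulNr; congr (- _).
under eq_Rintegral do rewrite -mulrA.
by rewrite RintegralZl//; exact: segment_integrable.
Qed.

(** Unlike the sine, the cosine is nonzero at both ends, so the boundary terms must vanish through
    [P]. *)
Lemma segment_integral_cos (P Pz : R -> R) : continuous P -> continuous Pz ->
  (forall z : R, 0 < z < 1 -> is_derive z 1 P (Pz z)) -> P 0 = 0 -> P 1 = 0 ->
  \int[mu]_(z in `[0, 1]) (cos (pi * z) * Pz z) =
  pi * \int[mu]_(z in `[0, 1]) (sin (pi * z) * P z).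
Proof.
move=> cP cPz dP P0 P1.
have cs : continuous (fun z : R => cos (pi * z)) by solve_cont.
have cc : continuous (fun z : R => - pi * sin (pi * z)) by solve_cont.
have c0 : continuous (fun z : R => sin (pi * z) * P z) by solve_cont.
rewrite (segment_by_parts ltr01 cs cP cc cPz (fun z _ => is_derive_cospi z) dP).
rewrite P0 P1 !mulr0 subrr sub0r.
under eq_Rintegral do rewrite -mulrA.
by rewrite RintegralZl//; [rewrite mulNr opprK|exact: segment_integrable].
Qed.

Lemma rect_integral_sin (w : R -> R) (P Pz : R -> R -> R) : continuous w ->
  continuous (fun p => P p.1 p.2) -> continuous (fun p => Pz p.1 p.2) ->
  (forall r z : R, 1 <= r <= N -> 0 < z < 1 -> is_derive z 1 (P r) (Pz r z)) ->
  I (fun p => w p.1 * (sin (pi * p.2) * Pz p.1 p.2)) =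
  - pi * I (fun p => w p.1 * (cos (pi * p.2) * P p.1 p.2)).
Proof.
move=> cw cP cPz dP.
have cw1 : continuous (fun p : R * R => w p.1) by solve_cont.
rewrite -rect_integralZ; last by solve_cont.
apply: eq_rect_integral_inner_snd; [by solve_cont..|move=> r hr /=].
have cPr := @cont_pairl R _ r cP; have cPzr := @cont_pairl R _ r cPz.
have := segment_integral_sin cPr cPzr (fun z hz => dP r z hr hz).
rewrite RintegralZl//; last by apply: segment_integrable; solve_cont.
rewrite RintegralZl//; last by apply: segment_integrable; solve_cont.
rewrite /= => ->.
rewrite RintegralZl//; last by apply: segment_integrable; solve_cont.
by rewrite mulrCA.
Qed.

Lemma rect_integral_cos (w : R -> R) (P Pz : R -> R -> R) : continuous w ->
  continuous (fun p => P p.1 p.2) -> continuous (fun p => Pz p.1 p.2) ->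
  (forall r z : R, 1 <= r <= N -> 0 < z < 1 -> is_derive z 1 (P r) (Pz r z)) ->
  (forall r : R, 1 <= r <= N -> P r 0 = 0 /\ P r 1 = 0) ->
  I (fun p => w p.1 * (cos (pi * p.2) * Pz p.1 p.2)) =
  pi * I (fun p => w p.1 * (sin (pi * p.2) * P p.1 p.2)).
Proof.
move=> cw cP cPz dP P01.
have cw1 : continuous (fun p : R * R => w p.1) by solve_cont.
rewrite -rect_integralZ; last by solve_cont.
apply: eq_rect_integral_inner_snd; [by solve_cont..|move=> r hr /=].
have cPr := @cont_pairl R _ r cP; have cPzr := @cont_pairl R _ r cPz.
have [P0 P1] := P01 _ hr.
have := segment_integral_cos cPr cPzr (fun z hz => dP r z hr hz) P0 P1.
rewrite RintegralZl//; last by apply: segment_integrable; solve_cont.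
rewrite RintegralZl//; last by apply: segment_integrable; solve_cont.
rewrite /= => ->.
rewrite RintegralZl//; last by apply: segment_integrable; solve_cont.
by rewrite mulrCA.
Qed.

(* Both boundary terms at [r = 1] carry the Robin condition, which [radial]
   shares with [P]; those at [r = N] vanish with [radial]. *)
Lemma segment_integral_radial (P Pr Prr : R -> R) :
  continuous P -> continuous Pr -> continuous Prr ->
  (forall r : R, 1 < r < N -> is_derive r 1 P (Pr r)) ->
  (forall r : R, 1 < r < N -> is_derive r 1 Pr (Prr r)) ->
  Pr 1 + 2 * al * P 1 = 0 ->
  \int[mu]_(r in `[1, N])
    (P r * (weight al eps r + pi ^+ 2 * (r ^+ 3 * radial al eps r))) =
  \int[mu]_(r in `[1, N]) ((r ^+ 3 * Prr r + 3 * r ^+ 2 * Pr r) * radial al eps r).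
Proof.
move=> cP cPr cPrr dP dPr bc.
have cW := @cont_weight R al eps; have cq := @cont_radial R al eps.
have cq' := @cont_radial' R al eps.
have cq3 : continuous (fun r : R => r ^+ 3 * radial' al eps r) by solve_cont.
have cD : continuous (fun r : R => weight al eps r + pi ^+ 2 * (r ^+ 3 * radial al eps r)).
  by solve_cont.
rewrite (segment_by_parts ltr1N cP cq3 cPr cD dP (fun r _ => is_derive_radial' al eps r)).
have cPr3 : continuous (fun r : R => r ^+ 3 * Pr r) by solve_cont.
have cdPr3 : continuous (fun r : R => r ^+ 3 * Prr r + 3 * r ^+ 2 * Pr r) by solve_cont.
have dPr3 (r : R) : 1 < r < N ->
    is_derive r 1 (fun r => r ^+ 3 * Pr r) (r ^+ 3 * Prr r + 3 * r ^+ 2 * Pr r).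
  move=> hr; have h := dPr r hr; apply: is_derive_eq.
  rewrite /GRing.scale/=; ring.
have := segment_by_parts ltr1N cPr3 cq cdPr3 cq' dPr3 (fun r _ => is_derive_radial al eps r).
rewrite radial'_last radial_last radial'_first radial_first.
have -> : \int[mu]_(x in `[1, N]) (Pr x * (x ^+ 3 * radial' al eps x)) =
    \int[mu]_(x in `[1, N]) (x ^+ 3 * Pr x * radial' al eps x).
  by apply: eq_Rintegral => x _; ring.
rewrite !mulr0 => ->.
have : (Pr 1 + 2 * al * P 1) * gauss al 1 = 0 by rewrite bc mul0r.
rewrite !expr1n !mul1r; lra.
Qed.

(** Green's formula with test function [radial] times the cosine: one integration in [z] moves the
    derivative off [Pz], the radial part is symmetric thanks to the common Robin condition, and the
    Neumann condition makes the part in [z] symmetric. *)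
Lemma spatial_identity (P Pr Pz Prr Pzz om : R -> R -> R) :
  continuous (fun p => P p.1 p.2) -> continuous (fun p => Pr p.1 p.2) ->
  continuous (fun p => Pz p.1 p.2) -> continuous (fun p => Prr p.1 p.2) ->
  continuous (fun p => Pzz p.1 p.2) -> continuous (fun p => om p.1 p.2) ->
  (forall r z : R, 1 < r < N -> 0 <= z <= 1 -> is_derive r 1 (P ^~ z) (Pr r z)) ->
  (forall r z : R, 1 < r < N -> 0 <= z <= 1 -> is_derive r 1 (Pr ^~ z) (Prr r z)) ->
  (forall r z : R, 1 <= r <= N -> 0 < z < 1 -> is_derive z 1 (P r) (Pz r z)) ->
  (forall r z : R, 1 <= r <= N -> 0 < z < 1 -> is_derive z 1 (Pz r) (Pzz r z)) ->
  (forall r z : R, 1 <= r <= N -> 0 <= z <= 1 ->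
     r ^+ 3 * om r z = - (r ^+ 3 * Prr r z + 3 * r ^+ 2 * Pr r z + r ^+ 3 * Pzz r z)) ->
  (forall z : R, 0 <= z <= 1 -> Pr 1 z + 2 * al * P 1 z = 0) ->
  (forall r : R, 1 <= r <= N -> Pz r 0 = 0 /\ Pz r 1 = 0) ->
  I (fun p => weight al eps p.1 * (sin (pi * p.2) * Pz p.1 p.2)) =
  pi * I (fun p => p.1 ^+ 3 * radial al eps p.1 * (cos (pi * p.2) * om p.1 p.2)).
Proof.
move=> cP cPr cPz cPrr cPzz com dPr dPrr dPz dPzz omE bc bz.
have cW := @cont_weight R al eps; have cq := @cont_radial R al eps.
rewrite (rect_integral_sin cW cP cPz dPz).
have cw : continuous (fun r : R => r ^+ 3 * radial al eps r) by solve_cont.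
have h1 := rect_integral_sin cw cP cPz dPz.
have h2 := rect_integral_cos cw cPz cPzz dPzz bz.
have h3 : I (fun p => cos (pi * p.2) * (P p.1 p.2 *
      (weight al eps p.1 + pi ^+ 2 * (p.1 ^+ 3 * radial al eps p.1)))) =
    I (fun p => cos (pi * p.2) *
      ((p.1 ^+ 3 * Prr p.1 p.2 + 3 * p.1 ^+ 2 * Pr p.1 p.2) * radial al eps p.1)).
  apply: eq_rect_integral_inner_fst; [by solve_cont..|move=> z hz /=].
  have cPz' := @cont_pairr R _ z cP; have cPrz := @cont_pairr R _ z cPr.
  have cPrrz := @cont_pairr R _ z cPrr.
  have := segment_integral_radial cPz' cPrz cPrrz (fun r hr => dPr r z hr hz)
    (fun r hr => dPrr r z hr hz) (bc z hz).
  rewrite /= in cPz' cPrz cPrrz *.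
  rewrite RintegralZl//; last by apply: segment_integrable; solve_cont.
  rewrite RintegralZl//; last by apply: segment_integrable; solve_cont.
  by move=> ->.
have e1 : I (fun p => cos (pi * p.2) * (P p.1 p.2 *
      (weight al eps p.1 + pi ^+ 2 * (p.1 ^+ 3 * radial al eps p.1)))) =
    I (fun p => weight al eps p.1 * (cos (pi * p.2) * P p.1 p.2)) +
    pi ^+ 2 * I (fun p => p.1 ^+ 3 * radial al eps p.1 * (cos (pi * p.2) * P p.1 p.2)).
  rewrite -rect_integralZ; last by solve_cont.
  rewrite -rect_integralD; [|by solve_cont..].
  by apply: eq_Rintegral => p _; ring.
have e2 : I (fun p => cos (pi * p.2) *
      ((p.1 ^+ 3 * Prr p.1 p.2 + 3 * p.1 ^+ 2 * Pr p.1 p.2) * radial al eps p.1)) +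
    I (fun p => p.1 ^+ 3 * radial al eps p.1 * (cos (pi * p.2) * Pzz p.1 p.2)) =
   - 1 * I (fun p => p.1 ^+ 3 * radial al eps p.1 * (cos (pi * p.2) * om p.1 p.2)).
  rewrite -rect_integralZ; last by solve_cont.
  rewrite -rect_integralD; [|by solve_cont..].
  apply: eq_Rintegral => -[r z]; rewrite inE => -[/=]; rewrite !in_itv/= => hr hz.
  have := omE r z hr hz => /(congr1 (fun x => - (cos (pi * z) * radial al eps r) * x)).
  by move=> h; ring: h.
(* Against the cosine, [Pzz] acts as [- pi ^+ 2] times [P], which cancels the [pi ^+ 2] term of
   [e1]. *)
rewrite h1 in h2; rewrite h3 in e1; rewrite h2 in e2.
rewrite mulNr -mulrN; congr (_ * _).
move: e1 e2; rewrite expr2; lra.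
Qed.

End SpatialIdentity.

(** * Evolution of the moments *)

Definition clamp (R : realType) (a b x : R) : R := Num.max a (Num.min b x).

Lemma clamp_in (R : realType) (a b x : R) : a <= b -> a <= clamp a b x <= b.
Proof. by move=> ab; rewrite /clamp le_max lexx ge_max ab ge_min lexx. Qed.

Lemma clamp_id (R : realType) (a b x : R) : a <= x <= b -> clamp a b x = x.
Proof. by move=> /andP[ax xb]; rewrite /clamp (min_idPr xb) (max_idPr ax). Qed.

Lemma cont_clamp (R : realType) (a b : R) : continuous (clamp a b).
Proof. by rewrite /clamp; solve_cont. Qed.

(** Being frozen outside [[0, tau]] turns bounds on a compact time interval into bounds for all
    times, as needed by statements that quantify over all of R. *)
Definition tame (R : realType) (tau : R) (f : R -> R -> R -> R) : Prop :=
  joint_continuous f /\ forall t, f t = f (clamp 0 tau t).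

(* The classical content of a solution on the truncated domain
   [0, tau] x [1, 1 + 1/eps] x [0, 1], with every function extended to all of
   R^3 by clamping its arguments. *)
Record truncated_solution (R : realType) (al eps tau : R)
    (u psi psir psiz psirr psizz om omt : R -> R -> R -> R) : Prop := {
  ts_u : tame tau u;
  ts_psi : tame tau psi;
  ts_psir : tame tau psir;
  ts_psiz : tame tau psiz;
  ts_psirr : tame tau psirr;
  ts_psizz : tame tau psizz;
  ts_om : tame tau om;
  ts_omt : tame tau omt;
  ts_dpsi_r : forall t r z : R, 0 <= t <= tau -> 1 < r < 1 + eps^-1 -> 0 <= z <= 1 ->
    is_derive r 1 (fun r => psi t r z) (psir t r z);
  ts_dpsir_r : forall t r z : R, 0 <= t <= tau -> 1 < r < 1 + eps^-1 -> 0 <= z <= 1 ->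
    is_derive r 1 (fun r => psir t r z) (psirr t r z);
  ts_dpsi_z : forall t r z : R, 0 <= t <= tau -> 1 <= r <= 1 + eps^-1 -> 0 < z < 1 ->
    is_derive z 1 (psi t r) (psiz t r z);
  ts_dpsiz_z : forall t r z : R, 0 <= t <= tau -> 1 <= r <= 1 + eps^-1 -> 0 < z < 1 ->
    is_derive z 1 (psiz t r) (psizz t r z);
  ts_du2_z : forall t r z : R, 0 < t < tau -> 1 <= r <= 1 + eps^-1 -> 0 < z < 1 ->
    is_derive z 1 (fun z => u t r z ^+ 2) (omt t r z);
  ts_du_t : forall t r z : R, 0 < t < tau -> 1 <= r <= 1 + eps^-1 -> 0 <= z <= 1 ->
    is_derive t 1 (fun t => u t r z) (2 * psiz t r z * u t r z);
  ts_dom_t : forall t r z : R, 0 < t < tau -> 1 <= r <= 1 + eps^-1 -> 0 <= z <= 1 ->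
    is_derive t 1 (fun t => om t r z) (omt t r z);
  ts_omE : forall t r z : R, 0 <= t <= tau -> 1 <= r <= 1 + eps^-1 -> 0 <= z <= 1 ->
    r ^+ 3 * om t r z =
    - (r ^+ 3 * psirr t r z + 3 * r ^+ 2 * psir t r z + r ^+ 3 * psizz t r z);
  ts_robin : forall t z : R, 0 <= t <= tau -> 0 <= z <= 1 ->
    psir t 1 z + 2 * al * psi t 1 z = 0;
  ts_neumann : forall t r : R, 0 <= t <= tau -> 1 <= r <= 1 + eps^-1 ->
    psiz t r 0 = 0 /\ psiz t r 1 = 0;
  ts_u0_bd : forall r : R, 1 <= r <= 1 + eps^-1 -> u 0 r 0 = 0 /\ u 0 r 1 = 0;
  ts_u0_pos : forall r z : R, 1 <= r <= 1 + eps^-1 -> 0 < z < 1 -> u 0 r z != 0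
}.

Section TruncatedEvolution.
Context {R : realType}.
Local Notation mu2 := (@lebesgue_measure R \x @lebesgue_measure R)%E.
Variables (al eps tau : R).
Variables u psi psir psiz psirr psizz om omt : R -> R -> R -> R.
Hypothesis eps0 : 0 < eps.
Hypothesis tau0 : 0 < tau.
Hypothesis ts : truncated_solution al eps tau u psi psir psiz psirr psizz om omt.
Let N := 1 + eps^-1.
Local Notation K := (rect 1 N 0 1).
Local Notation I f := (\int[mu2]_(p in K) f p).

(** The truncated forms of [a(t)], of [b(t)], and of the integral of [u ^+ 2] against [phi]. In the
    first two the factor [r ^+ 3] of the measure is already part of [weight]. *)
Definition log_moment (t : R) : R :=
  I (fun p => weight al eps p.1 * (sin (pi * p.2) * ln (u t p.1 p.2 ^+ 2))).
Definition flux_moment (t : R) : R :=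
  I (fun p => weight al eps p.1 * (sin (pi * p.2) * psiz t p.1 p.2)).
Definition energy (t : R) : R :=
  I (fun p => p.1 ^+ 3 * radial al eps p.1 * (sin (pi * p.2) * u t p.1 p.2 ^+ 2)).

Let Kin p : K p -> 1 <= p.1 <= N /\ 0 <= p.2 <= 1.
Proof. by case=> /=; rewrite !in_itv. Qed.

Let clt t : 0 <= clamp 0 tau t <= tau.
Proof. exact/clamp_in/ltW. Qed.

Lemma tame_bounded f : tame tau f ->
  exists M, forall t p, K p -> `|f t p.1 p.2| <= M.
Proof.
move=> [cf fc]; have [M hM] := @joint_continuous_bounded R f 0 tau N cf.
by exists M => t p /Kin[h1 h2]; rewrite fc; exact: hM.
Qed.

Lemma tame_slice f t : tame tau f -> continuous (fun p => f t p.1 p.2).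
Proof. by move=> [cf _]; solve_cont. Qed.

Lemma tame_time f r z : tame tau f -> continuous (fun t => f t r z).
Proof. by move=> [cf _]; solve_cont. Qed.

Lemma weighted_bounded (w : R -> R -> R) f :
  joint_continuous (fun _ r z => w r z) -> tame tau f ->
  exists M, forall t p, K p -> `|w p.1 p.2 * f t p.1 p.2| <= M.
Proof.
move=> cw tf; have [M hM] := tame_bounded tf.
have [B hB] := @joint_continuous_bounded R _ 0 1 N cw.
exists (B * M) => t p Kp; rewrite normrM; apply: ler_pM => //; last exact: hM.
by have [h1 h2] := Kin Kp; apply: (hB 0) => //; rewrite lexx ler01.
Qed.

Let tsu := ts_u ts.
Let tsz := ts_psiz ts.
Let tsom := ts_om ts.
Let tsomt := ts_omt ts.

(** Passes from [psiz] to the vorticity, the quantity whose time derivative the model prescribes. *)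
Lemma flux_momentE t : 0 <= t <= tau -> flux_moment t =
  pi * I (fun p => p.1 ^+ 3 * radial al eps p.1 * (cos (pi * p.2) * om t p.1 p.2)).
Proof.
move=> ht; apply: (@spatial_identity _ al eps eps0 (psi t) (psir t) (psiz t)
  (psirr t) (psizz t) (om t)).
- exact: tame_slice (ts_psi ts).
- exact: tame_slice (ts_psir ts).
- exact: tame_slice (ts_psiz ts).
- exact: tame_slice (ts_psirr ts).
- exact: tame_slice (ts_psizz ts).
- exact: tame_slice (ts_om ts).
- by move=> r z; exact: (ts_dpsi_r ts).
- by move=> r z; exact: (ts_dpsir_r ts).
- by move=> r z; exact: (ts_dpsi_z ts).
- by move=> r z; exact: (ts_dpsiz_z ts).
- by move=> r z; exact: (ts_omE ts).
- by move=> z; exact: (ts_robin ts).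
- by move=> r; exact: (ts_neumann ts).
Qed.

Let wom (r z : R) := r ^+ 3 * radial al eps r * cos (pi * z).

Let cwom : joint_continuous (fun _ => wom).
Proof.
have cq := @cont_radial R al eps.
by rewrite /joint_continuous /wom; solve_cont.
Qed.

Lemma cont_flux_moment : continuous flux_moment.
Proof.
have -> : flux_moment = fun t => pi * I (fun p => wom p.1 p.2 * om t p.1 p.2).
  (* [flux_momentE] covers times in [[0, tau]]; clamping brings every time there. *)
  apply/funext => t; have E : flux_moment t = flux_moment (clamp 0 tau t).
    by rewrite /flux_moment (proj2 tsz t).
  rewrite E flux_momentE// (proj2 tsom t); congr (_ * _).
  by apply: eq_Rintegral => p _; rewrite /wom mulrA.
have [M hM] := weighted_bounded cwom tsom.
suff h : continuous (fun t => I (fun p => wom p.1 p.2 * om t p.1 p.2)) by solve_cont.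
have cq := @cont_radial R al eps.
apply: (@cont_rect_integral R N (fun t p => wom p.1 p.2 * om t p.1 p.2) (cst M)).
- move=> t; apply: rect_integrable; have cs := tame_slice (t := t) tsom.
  by rewrite /wom; solve_cont.
- by move=> p _; have cs := tame_time (r := p.1) (z := p.2) tsom; solve_cont.
- by apply: rect_integrable; exact: cont_cst.
- by move=> t p; exact: hM.
Qed.

Let itv_oo_cc (z : R) : 0 < z < 1 -> 0 <= z <= 1.
Proof. by move=> /andP[z0 z1]; rewrite !ltW. Qed.

(** At a fixed point of space the first equation is linear in [u] with the bounded coefficient
    [2 * psiz]. Hence [u ^+ 2] stays comparable to its initial value: zeros persist, none appear,
    and its logarithm moves by a bounded amount. *)
Lemma u_sqr_bounds : exists M, 0 <= M /\ forall t r z, 1 <= r <= N -> 0 <= z <= 1 ->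
  u 0 r z ^+ 2 * expR (- M) <= u t r z ^+ 2 <= u 0 r z ^+ 2 * expR M.
Proof.
have [M hM] := tame_bounded tsz.
have M0 : 0 <= M.
  apply: le_trans (hM 0 (1, 0) _); first exact: normr_ge0.
  by split; rewrite /= in_itv/= ?lexx ?ler01// lerDl invr_ge0 ltW.
(* [2 * M] bounds the coefficient, the other 2 comes from squaring [u], and [tau] is the longest
   elapsed time. *)
exists (2 * (2 * M) * tau); split.
  by rewrite mulr_ge0 ?(ltW tau0)// mulr_ge0// mulr_ge0.
move=> t r z hr hz; rewrite (proj2 tsu t).
have /andP[s0 st] := clt t.
have := @linear_ode_sqr_bounds R (fun t => u t r z) (fun t => 2 * psiz t r z) tau (2 * M)
  (tame_time (r := r) (z := z) tsu) (fun t ht => ts_du_t ts ht hr hz).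
have hb (s : R) : 0 < s < tau -> `|2 * psiz s r z| <= 2 * M.
  move=> _; rewrite normrM ger0_norm// ler_wpM2l//.
  by apply: (hM s (r, z)); split; rewrite /= in_itv.
move=> /(_ hb _ (clt t)) /andP[l1 l2].
have h : 2 * (2 * M) * clamp 0 tau t <= 2 * (2 * M) * tau.
  by rewrite ler_wpM2l// mulr_ge0// mulr_ge0.
apply/andP; split.
  apply: le_trans l1; rewrite ler_wpM2l ?sqr_ge0// ler_expR mulNr lerN2//.
by apply: le_trans l2 _; rewrite ler_wpM2l ?sqr_ge0// ler_expR.
Qed.

(** Removes the boundary terms when the derivative of [u ^+ 2] in [z] is integrated against the
    cosine. *)
Lemma u_boundary t r : 1 <= r <= N -> u t r 0 = 0 /\ u t r 1 = 0.
Proof.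
move=> hr; have [M [M0 hM]] := u_sqr_bounds; have [e0 e1] := ts_u0_bd ts hr.
split.
- have := hM t r 0 hr; rewrite e0 expr0n/= !mul0r lexx ler01 => /(_ isT) /andP[_ h].
  by apply/eqP; rewrite -sqrf_eq0 eq_le h sqr_ge0.
- have := hM t r 1 hr; rewrite e1 expr0n/= !mul0r lexx ler01 => /(_ isT) /andP[_ h].
  by apply/eqP; rewrite -sqrf_eq0 eq_le h sqr_ge0.
Qed.

Lemma is_derive_flux_moment t : 0 < t < tau ->
  is_derive t 1 flux_moment (pi ^+ 2 * energy t).
Proof.
move=> ht.
have cq := @cont_radial R al eps.
have [M hM] := weighted_bounded cwom tsomt.
have h : is_derive t 1 (fun t => I (fun p => wom p.1 p.2 * om t p.1 p.2))
    (I (fun p => wom p.1 p.2 * omt t p.1 p.2)).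
  apply: (@is_derive_rect_integral R N tau (fun t p => wom p.1 p.2 * om t p.1 p.2)
    (fun t p => wom p.1 p.2 * omt t p.1 p.2) M _ _ _ t ht).
  - move=> s; apply: rect_integrable; have cs := tame_slice (t := s) tsom.
    by rewrite /wom; solve_cont.
  - move=> s p hs /Kin[h1 h2]; have h := ts_dom_t ts hs h1 h2.
    by apply: is_derive_eq; rewrite /GRing.scale/= ?mul0r ?addr0.
  - by move=> s p _; exact: hM.
have h' : is_derive t 1 (fun t => pi * I (fun p => wom p.1 p.2 * om t p.1 p.2))
    (pi * I (fun p => wom p.1 p.2 * omt t p.1 p.2)).
  by apply: is_derive_eq; rewrite /GRing.scale/= ?mul0r ?addr0.
(* The vorticity form of the moment holds on [[0, tau]], thus in a neighbourhood of [t]. *)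
apply: (@near_eq_is_derive _ _ _
  (fun t => pi * I (fun p => wom p.1 p.2 * om t p.1 p.2))).
  have := @near_in_itvoo R 0 tau t; rewrite in_itv/= => /(_ ht).
  apply: filterS => s; rewrite in_itv/= => /andP[s0 st].
  rewrite flux_momentE ?ltW//; congr (_ * _).
  by apply: eq_Rintegral => p _; rewrite /wom mulrA.
move/is_derive_eq: h'; apply; rewrite expr2 -mulrA; congr (_ * _).
have cu := tame_slice (t := t) tsu; have comt := tame_slice (t := t) tsomt.
have cu2 : continuous (fun p => u t p.1 p.2 ^+ 2) by solve_cont.
have cw : continuous (fun r : R => r ^+ 3 * radial al eps r) by solve_cont.
have bd r : 1 <= r <= N -> u t r 0 ^+ 2 = 0 /\ u t r 1 ^+ 2 = 0.
  by move=> hr; have [-> ->] := u_boundary t hr; rewrite expr0n.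
(* [omt] is the derivative of [u ^+ 2] in [z]; integrating it by parts gives the second factor
   [pi]. *)
have <- := @rect_integral_cos R eps _ (fun r z => u t r z ^+ 2) (omt t) cw cu2 comt
  (fun r z => @ts_du2_z _ _ _ _ _ _ _ _ _ _ _ _ ts t r z ht) bd.
by apply: eq_Rintegral => p _; rewrite /wom mulrA.
Qed.

Lemma u_neq0 t r z : 1 <= r <= N -> 0 < z < 1 -> u t r z != 0.
Proof.
move=> hr hz; have [M [M0 hM]] := u_sqr_bounds.
have /andP[h _] := hM t r z hr (itv_oo_cc hz).
have : 0 < u t r z ^+ 2.
  by apply: lt_le_trans h; rewrite mulr_gt0 ?expR_gt0// exprn_even_gt0//= (ts_u0_pos ts).
by rewrite exprn_even_gt0.
Qed.

Let sin0z (z : R) : 0 <= z <= 1 -> sin (pi * z) != 0 -> 0 < z < 1.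
Proof.
move=> /andP[z0 z1] s0; rewrite !lt_neqAle z0 z1 !andbT; apply/andP; split.
  by apply: contraNneq s0 => <-; rewrite mulr0 sin0.
by apply: contraNneq s0 => ->; rewrite mulr1 sinpi.
Qed.

Let wlog (t : R) (p : R * R) : R :=
  weight al eps p.1 * (sin (pi * p.2) * ln (u t p.1 p.2 ^+ 2)).

Hypothesis iwlog0 : mu2.-integrable K (EFin \o wlog 0).

(** The initial integrand plus a multiple of the weight dominates the integrand at all times, so
    integrability at time 0 propagates and dominated convergence applies. *)
Lemma wlog_bound : exists M, 0 <= M /\ forall t p, K p ->
  `|wlog t p| <= `|wlog 0 p| + `|weight al eps p.1| * M.
Proof.
have [M [M0 hM]] := u_sqr_bounds; exists M; split => // t p /Kin[h1 h2].
rewrite /wlog !normrM -mulrDr ler_wpM2l//.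
(* Where the sine vanishes so does the integrand; elsewhere [z] is interior and [u] is nonzero, so
   the logarithm obeys its product rule. *)
have [->|s0] := eqVneq (sin (pi * p.2)) 0.
  by rewrite normr0 !mul0r add0r.
have hz := sin0z h2 s0.
have ut2 : 0 < u t p.1 p.2 ^+ 2 by rewrite exprn_even_gt0//= u_neq0.
have u02 : 0 < u 0 p.1 p.2 ^+ 2 by rewrite exprn_even_gt0//= u_neq0.
have /andP[l1 l2] := hM t p.1 p.2 h1 h2.
have {}l1 : ln (u 0 p.1 p.2 ^+ 2) - M <= ln (u t p.1 p.2 ^+ 2).
  rewrite -[X in _ - X]expRK -lnV ?posrE ?expR_gt0// -lnM ?posrE ?invr_gt0 ?expR_gt0//.
  by rewrite expRN in l1; rewrite ler_ln ?posrE// divr_gt0// expR_gt0.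
have {}l2 : ln (u t p.1 p.2 ^+ 2) <= ln (u 0 p.1 p.2 ^+ 2) + M.
  rewrite -[X in _ + X]expRK -lnM ?posrE ?expR_gt0//.
  by rewrite ler_ln ?posrE// mulr_gt0// expR_gt0.
have hl : `|ln (u t p.1 p.2 ^+ 2)| <= `|ln (u 0 p.1 p.2 ^+ 2)| + M.
  apply: (@le_trans _ _ (`|ln (u 0 p.1 p.2 ^+ 2)| +
    `|ln (u t p.1 p.2 ^+ 2) - ln (u 0 p.1 p.2 ^+ 2)|)).
    by rewrite -{1}[ln (u t _ _ ^+ 2)](subrKC (ln (u 0 p.1 p.2 ^+ 2))) ler_normD.
  rewrite lerD2l ler_norml; apply/andP; split; lra.
apply: (@le_trans _ _ (`|sin (pi * p.2)| * (`|ln (u 0 p.1 p.2 ^+ 2)| + M))).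
  by rewrite ler_wpM2l.
by rewrite mulrDr lerD2l ler_piMl// sin_max.
Qed.

Let iwlogG M : mu2.-integrable K (EFin \o (fun p => `|wlog 0 p| + `|weight al eps p.1| * M)).
Proof.
have cW := @cont_weight R al eps.
have i1 := integrable_norm iwlog0.
have i2 : mu2.-integrable K (EFin \o (fun p => `|weight al eps p.1| * M)).
  by apply: rect_integrable; solve_cont.
exact: (integrableD (measurable_rect _ _ _ _) i1 i2).
Qed.

Let mwlog t : measurable_fun setT (wlog t : measurableTypeR R * measurableTypeR R -> R).
Proof.
have cW := @cont_weight R al eps.
have cs := tame_slice (t := t) tsu.
have h1 : measurable_fun setT
    ((fun p => weight al eps p.1 * sin (pi * p.2)) : measurableTypeR R * measurableTypeR R -> R).
  by apply: continuous_measurable_plane; solve_cont.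
have h2 : measurable_fun setT
    ((fun p => u t p.1 p.2 ^+ 2) : measurableTypeR R * measurableTypeR R -> R).
  by apply: continuous_measurable_plane; solve_cont.
have h3 := measurableT_comp (@measurable_ln R) h2.
have := measurable_funM h1 h3; congr measurable_fun; apply/funext => p.
by rewrite /wlog /= mulrA.
Qed.

Lemma wlog_integrable t : mu2.-integrable K (EFin \o wlog t).
Proof.
have [M [M0 hM]] := wlog_bound.
apply: le_integrable (iwlogG M); first exact: measurable_rect.
  by apply/measurable_EFinP; apply: measurable_funTS; exact: mwlog.
move=> p Kp /=; rewrite lee_fin; apply: le_trans (hM t p Kp) _.
exact: ler_norm.
Qed.

Lemma cont_log_moment : continuous log_moment.
Proof.
have [M [M0 hM]] := wlog_bound.
apply: (@cont_rect_integral R N wlog _ wlog_integrable _ (iwlogG M) hM) => p /Kin[h1 h2].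
rewrite /wlog; have [->|s0] := eqVneq (sin (pi * p.2)) 0.
  under [X in continuous X]eq_fun do rewrite mul0r mulr0.
  exact: cont_cst.
have hz := sin0z h2 s0.
have cs := tame_time (r := p.1) (z := p.2) tsu.
have c2 : continuous (fun t => u t p.1 p.2 ^+ 2) by solve_cont.
have cl : continuous (fun t => ln (u t p.1 p.2 ^+ 2)).
  move=> t; have ut2 : 0 < u t p.1 p.2 ^+ 2 by rewrite exprn_even_gt0//= u_neq0.
  exact: (continuous_comp (c2 t) (continuous_ln ut2)).
by solve_cont.
Qed.

Lemma is_derive_log_moment t : 0 < t < tau ->
  is_derive t 1 log_moment (4 * flux_moment t).
Proof.
move=> ht.
have cW := @cont_weight R al eps.
have cws : joint_continuous (fun _ r z => weight al eps r * sin (pi * z)).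
  by rewrite /joint_continuous; solve_cont.
have [M hM] := weighted_bounded cws tsz.
have cs := tame_slice (t := t) tsz.
have h : is_derive t 1 log_moment
    (I (fun p => 4 * (weight al eps p.1 * (sin (pi * p.2) * psiz t p.1 p.2)))).
  apply: (@is_derive_rect_integral R N tau wlog
    (fun t p => 4 * (weight al eps p.1 * (sin (pi * p.2) * psiz t p.1 p.2)))
    (4 * M) wlog_integrable _ _ t ht).
  - move=> s p hs /Kin[h1 h2]; rewrite /wlog.
    have [->|s0] := eqVneq (sin (pi * p.2)) 0.
      rewrite mul0r !mulr0; under eq_fun do rewrite mul0r mulr0.
      exact: is_derive_cst.
    have hz := sin0z h2 s0.
    (* One factor 2 comes from the square inside the logarithm and one from the equation for [u],
       whence the 4. *)
    have d := is_derive_ln_sqr (u_neq0 s h1 hz) (ts_du_t ts hs h1 h2).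
    apply: is_derive_eq; rewrite /GRing.scale/=; ring.
  - move=> s p hs Kp; rewrite normrM ger0_norm// ler_wpM2l// mulrA.
    exact: hM.
move/is_derive_eq: h; apply.
by rewrite rect_integralZ//; solve_cont.
Qed.

End TruncatedEvolution.

(** * Lower bound of the energy by the squared logarithmic moment, and the resulting time bound *)

Section EnergyInequality.
Context {R : realType}.
Local Notation mu2 := (@lebesgue_measure R \x @lebesgue_measure R)%E.
Variables (al eps : R).
Hypothesis al2 : 2 <= al.
Hypothesis alpi : 8 * al + pi ^+ 2 <= 4 * al ^+ 2.
Hypothesis eps0 : 0 < eps.
Hypothesis eps_half : eps <= 2^-1.
Let N := 1 + eps^-1.
Local Notation K := (rect 1 N 0 1).
Local Notation I f := (\int[mu2]_(p in K) f p).

Let Kin p : K p -> 1 <= p.1 <= N /\ 0 <= p.2 <= 1.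
Proof. by case=> /=; rewrite !in_itv. Qed.

(** The integral of [weight ^+ 2 / radial] against the sine, the constant of the Cauchy-Schwarz
    inequality; the added 1 makes it strictly positive. *)
Definition holder_const : R :=
  I (fun p => sin (pi * p.2) * (gauss al p.1 * mult al eps p.1 ^+ 2)) + 1.

Let sinpi_ge0 (z : R) : 0 <= z <= 1 -> 0 <= sin (pi * z).
Proof.
move=> /andP[z0 z1]; apply: sin_ge0_pi; rewrite mulr_ge0 ?pi_ge0//=.
by rewrite ler_piMr// pi_ge0.
Qed.

Lemma holder_const_gt0 : 0 < holder_const.
Proof.
rewrite ltr_pwDr// Rintegral_ge0// => p /Kin[_ h2].
by rewrite mulr_ge0 ?sinpi_ge0// mulr_ge0 ?sqr_ge0// expR_ge0.
Qed.

(* AM-GM with a free parameter: optimising over [lam] gives the Cauchy-Schwarz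
   bound without a division by the radial weight. *)
Lemma log_weight_bound (lam v r z : R) : 0 < lam -> 1 <= r <= N -> 0 <= z <= 1 ->
  weight al eps r * (sin (pi * z) * ln (v ^+ 2)) <=
  lam * (sin (pi * z) * (gauss al r * mult al eps r ^+ 2)) +
  lam^-1 * (r ^+ 3 * radial al eps r * (sin (pi * z) * v ^+ 2)).
Proof.
move=> l0 hr hz; have m0 := mult_ge0 al2 alpi eps0 eps_half hr.
have s0 := sinpi_ge0 hz; have g0 : 0 <= gauss al r := expR_ge0 _.
have /andP[r1 _] := hr.
(* For [v = 0] the convention [ln 0 = 0] gives equality; otherwise this is twice [ln x < x]. *)
have lnv : ln (v ^+ 2) <= 2 * `|v|.
  have [->|v0] := eqVneq v 0; first by rewrite expr0n/= ln0// normr0 mulr0.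
  have v1 : 0 < `|v| by rewrite normr_gt0.
  have -> : ln (v ^+ 2) = 2 * ln `|v|.
    by rewrite -(real_normK (num_real v)) lnXn// mulr_natl.
  by rewrite ler_wpM2l// ltW// ln_sublinear.
set c := cut eps r; set m := mult al eps r in m0 *.
have amgm : c ^+ 2 * m * (2 * `|v|) <= lam * m ^+ 2 + lam^-1 * (c ^+ 4 * v ^+ 2).
  rewrite -subr_ge0.
  have -> : lam * m ^+ 2 + lam^-1 * (c ^+ 4 * v ^+ 2) - c ^+ 2 * m * (2 * `|v|) =
      lam * (m - lam^-1 * (c ^+ 2 * `|v|)) ^+ 2.
    rewrite -(real_normK (num_real v)); field; exact: lt0r_neq0.
  by rewrite mulr_ge0 ?sqr_ge0// ltW.
(* As [r >= 1], the factor [r ^+ 3] of the energy density is inserted at no cost. *)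
have r3 : c ^+ 4 * v ^+ 2 <= r ^+ 3 * (c ^+ 4 * v ^+ 2).
  have h : 0 <= c ^+ 4 * v ^+ 2.
    by rewrite (_ : _ * _ = (c ^+ 2 * v) ^+ 2) ?sqr_ge0//; ring.
  by rewrite ler_peMl// exprn_ege1.
have step : c ^+ 2 * m * ln (v ^+ 2) <= lam * m ^+ 2 + lam^-1 * (r ^+ 3 * (c ^+ 4 * v ^+ 2)).
  apply: (@le_trans _ _ (c ^+ 2 * m * (2 * `|v|))).
    by rewrite ler_wpM2l// mulr_ge0// sqr_ge0.
  apply: (le_trans amgm); rewrite lerD2l ler_wpM2l// invr_ge0 ltW//.
rewrite (_ : weight al eps r * _ =
    (sin (pi * z) * gauss al r) * (c ^+ 2 * m * ln (v ^+ 2))); last first.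
  by rewrite /weight -/c -/m; ring.
rewrite (_ : _ + _ = (sin (pi * z) * gauss al r) *
    (lam * m ^+ 2 + lam^-1 * (r ^+ 3 * (c ^+ 4 * v ^+ 2)))); last first.
  by rewrite /radial -/c; ring.
by rewrite ler_wpM2l// mulr_ge0.
Qed.

Lemma energy_lower_bound (u : R -> R -> R -> R) (t : R) :
  continuous (fun p => u t p.1 p.2) ->
  mu2.-integrable K (EFin \o (fun p =>
    weight al eps p.1 * (sin (pi * p.2) * ln (u t p.1 p.2 ^+ 2)))) ->
  0 < log_moment al eps u t ->
  pi ^+ 2 / (4 * holder_const) * log_moment al eps u t ^+ 2 <=
  pi ^+ 2 * energy al eps u t.
Proof.
move=> cu iu a0; have C0 := holder_const_gt0.
set a := log_moment al eps u t in a0 *; set C := holder_const in C0 *.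
set E := energy al eps u t.
have cg := @cont_gauss R al.
have cm := @cont_mult R al eps; have cq := @cont_radial R al eps.
have cH : continuous (fun p : R * R => sin (pi * p.2) * (gauss al p.1 * mult al eps p.1 ^+ 2)).
  by solve_cont.
have cE : continuous (fun p : R * R => p.1 ^+ 3 * radial al eps p.1 * (sin (pi * p.2) * u t p.1 p.2 ^+ 2)).
  by solve_cont.
have key lam : 0 < lam -> a <= lam * C + lam^-1 * E.
  move=> l0.
  have : a <= lam * (C - 1) + lam^-1 * E.
    rewrite /C /holder_const addrK /E /energy.
    rewrite -rect_integralZ// -rect_integralZ//.
    rewrite -rect_integralD//; [|by solve_cont..].
    apply: le_Rintegral => //; first exact: measurable_rect.
      by apply: rect_integrable; solve_cont.
    by move=> p /Kin[h1 h2]; exact: log_weight_bound.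
  move=> h; apply: le_trans h _; rewrite lerD2r ler_wpM2l ?(ltW l0)// gerBl//.
(* This [lam] makes the first term [a / 2], which is absorbed on the left; [a ^+ 2 <= 4 * C * E]
   remains. *)
have h := key (a / (2 * C)) (divr_gt0 a0 (mulr_gt0 (ltr0n _ 2) C0)).
have {}h : a ^+ 2 <= 4 * C * E.
  have e1 : a / (2 * C) * C = a / 2 by field; rewrite lt0r_neq0.
  have e2 : (a / (2 * C))^-1 * E = 2 * C * E / a by field; rewrite !lt0r_neq0.
  rewrite e1 e2 in h.
  have {}h : a / 2 <= 2 * C * E / a by lra.
  move: h; rewrite ler_pdivlMr// expr2 => h; lra.
rewrite -mulrA ler_wpM2l ?sqr_ge0//.
by rewrite mulrC ler_pdivrMr ?mulr_gt0// mulrC.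
Qed.

Lemma energy_ge0 (u : R -> R -> R -> R) (t : R) : 0 <= energy al eps u t.
Proof.
apply: Rintegral_ge0 => p /Kin[h1 h2]; have /andP[r1 _] := h1.
rewrite mulr_ge0//; last by rewrite mulr_ge0 ?sqr_ge0// sinpi_ge0.
rewrite mulr_ge0 ?exprn_ge0 ?(le_trans _ r1)// /radial.
by rewrite mulr_ge0 ?expR_ge0// exprn_ge0// (cut_ge0 eps0 h1).
Qed.

(** The bound is fixed before the solution: it depends on [al], [eps] and the two initial moments,
    hence is common to all solutions with the same data. *)
Lemma truncated_time_bound (a0 b0 : R) : 0 < a0 -> 0 < b0 ->
  exists Tmax : R, forall tau u psi psir psiz psirr psizz om omt, 0 < tau ->
    truncated_solution al eps tau u psi psir psiz psirr psizz om omt ->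
    mu2.-integrable K (EFin \o (fun p =>
      weight al eps p.1 * (sin (pi * p.2) * ln (u 0 p.1 p.2 ^+ 2)))) ->
    log_moment al eps u 0 = a0 -> flux_moment al eps psiz 0 = b0 ->
    tau <= Tmax.
Proof.
move=> ha hb; have C0 := holder_const_gt0.
pose kap := pi ^+ 2 / (4 * holder_const).
have kap0 : 0 < kap by rewrite divr_gt0// ?exprn_gt0 ?pi_gt0// mulr_gt0.
(* [d] is the square of the rate [c], taken as the largest value allowed by [6 * c ^+ 2 <= kap] and
   [c ^+ 2 * a0 ^+ 3 <= b0 ^+ 2]. *)
pose d := Num.min (kap / 6) (b0 ^+ 2 / a0 ^+ 3).
have d0 : 0 < d by rewrite lt_min; apply/andP; split; apply: divr_gt0 => //; exact: exprn_gt0.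
exists (2 * Num.sqrt d * Num.sqrt a0)^-1.
move=> tau u psi psir psiz psirr psizz om omt tau0 ts iu a0E b0E.
rewrite -a0E.
have sd : Num.sqrt d ^+ 2 = d by rewrite sqr_sqrtr// ltW.
apply: (@quadratic_ode_time_bound R (log_moment al eps u) (flux_moment al eps psiz)
  (fun t => pi ^+ 2 * energy al eps u t) tau kap).
- exact: tau0.
- by rewrite sqrtr_gt0.
- exact: (cont_log_moment eps0 tau0 ts iu).
- exact: (cont_flux_moment eps0 tau0 ts).
- exact: (is_derive_log_moment eps0 tau0 ts iu).
- exact: (is_derive_flux_moment eps0 tau0 ts).
- by move=> t _; rewrite mulr_ge0 ?sqr_ge0// energy_ge0.
- move=> t _ at0; apply: energy_lower_bound => //.
    exact: (tame_slice (ts_u ts)).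
  exact: (wlog_integrable eps0 tau0 ts iu).
- by rewrite a0E.
- by rewrite b0E.
- rewrite sd mulrC -ler_pdivlMr// ge_min lexx//.
- by rewrite sd a0E b0E -ler_pdivlMr ?exprn_gt0// ge_min lexx orbT.
Qed.

End EnergyInequality.

(** * One-sided derivatives *)

Section RelativeDerivative.
Context {R : realType}.
Implicit Types (A : set R) (f g : R -> R).

(** A segment leaving [x] inside [A] has points of [A] other than [x] arbitrarily near [x].
    Properness gives uniqueness of limits, so that [derive_in] can be evaluated. *)
Lemma proper_within_dnbhs A (x y : R) : y != x ->
  (forall t : R, 0 <= t <= 1 -> A (x + t * (y - x))) -> ProperFilter (within A x^').
Proof.
move=> yx Axy; apply: Build_ProperFilter_ex => P.
rewrite /within/= => /nbhs_ballP[e /= e0 eP].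
have d0 : 0 < `|y - x| by rewrite normr_gt0 subr_eq0.
pose t := Num.min 1 (e / (2 * `|y - x|)).
have t0 : 0 < t by rewrite lt_min ltr01 divr_gt0// mulr_gt0.
have t1 : t <= 1 by rewrite ge_min lexx.
exists (x + t * (y - x)); apply: eP.
- rewrite /ball/= opprD addrA subrr sub0r normrN normrM gtr0_norm//.
  apply: (@le_lt_trans _ _ (e / 2)); last by rewrite ltr_pdivrMr// ltr_pMr// ltr1n.
  have h : t <= e / (2 * `|y - x|) by rewrite ge_min lexx orbT.
  apply: le_trans (ler_wpM2r (ltW d0) h) _.
  by rewrite le_eqVlt; apply/orP; left; apply/eqP; field; rewrite lt0r_neq0.
- by rewrite -subr_eq0 addrC addKr mulf_neq0 ?subr_eq0// lt0r_neq0.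
- by apply: Axy; rewrite (ltW t0).
Qed.

Lemma proper_r_dom (r : R) : 1 <= r -> ProperFilter (within (r_dom R) r^').
Proof.
move=> r1; apply: (@proper_within_dnbhs _ r (r + 1)).
  by rewrite -subr_eq0 addrC addKr oner_eq0.
by move=> t /andP[t0 _]; rewrite /r_dom/= in_itv/= andbT (_ : r + 1 - r = 1) ?mulr1; [lra|ring].
Qed.

Lemma proper_z_dom (z : R) : 0 <= z <= 1 -> ProperFilter (within (z_dom R) z^').
Proof.
move=> /andP[z0 z1]; have [->|zn1] := eqVneq z 1.
  apply: (@proper_within_dnbhs _ 1 0); first by rewrite eq_sym oner_neq0.
  by move=> t /andP[t0 t1]; rewrite /z_dom/= in_itv/= sub0r mulrN1; apply/andP; split; lra.
apply: (@proper_within_dnbhs _ z 1); first by rewrite eq_sym.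
move=> t /andP[t0 t1]; rewrite /z_dom/= in_itv/=.
have h : 0 <= t * (1 - z) by rewrite mulr_ge0// subr_ge0.
have h' : 0 <= (1 - t) * (1 - z) by rewrite mulr_ge0 ?subr_ge0.
by apply/andP; split; lra.
Qed.

(** The two difference quotients correspond under the translation [y = h + x]. *)
Lemma diff_quot_cvgP f (x l : R) :
  diff_quot f x @ x^' --> l <-> is_derive x 1 f l.
Proof.
have E : (fun h => h^-1 *: ((f \o shift x) (h *: 1) - f x)) =
    (fun h => diff_quot f x (h + x)).
  by apply/funext => h /=; rewrite /diff_quot addrK mulrC /GRing.scale/= mulr1.
have H (F : set_system R) : (fun h => diff_quot f x (h + x)) @ 0^' --> F <->
    diff_quot f x @ x^' --> F.
  split=> h P /h.
  - rewrite /= => /nbhs_ballP[e /= e0 eP]; apply/nbhs_ballP; exists e => //= y xy yx.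
    have := eP (y - x); rewrite /ball/= sub0r normrN distrC subrK; apply.
      exact: xy.
    by rewrite subr_eq0.
  - rewrite /= => /nbhs_ballP[e /= e0 eP]; apply/nbhs_ballP; exists e => //= y xy yx.
    apply: eP; last by rewrite -subr_eq0 addrK.
    by move: xy; rewrite /ball/= sub0r normrN opprD addrCA subrr addr0 normrN.
split=> h.
  split; last by rewrite /derive E; apply/cvg_lim => //; exact/H.
  by apply/cvg_ex; exists l; rewrite E; exact/H.
have [/cvg_ex[l' hl'] dl] := h.
have : l' = l by rewrite -dl; apply/esym/cvg_lim.
by move=> <-; apply/H; rewrite -E.
Qed.

Lemma derive_in_interior A f (x : R) : nbhs x A -> derivable_in A f x ->
  is_derive x 1 f (derive_in A f x).
Proof.
move=> xA dA; apply/diff_quot_cvgP.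
apply: cvg_trans dA; apply: cvg_app => P; rewrite /within/= => h.
have xA' : x^' A by exact: (filterS _ xA).
by move: h; apply: filterS2 xA' => y Ay; apply.
Qed.

Lemma derive_in_val A f (x l : R) : ProperFilter (within A x^') ->
  is_derive x 1 f l -> derive_in A f x = l.
Proof.
move=> pA /diff_quot_cvgP h; apply/cvg_lim => //.
apply: cvg_trans h; apply: cvg_app => P hP; rewrite /within/=.
by apply: filterS hP => y Py _.
Qed.

Lemma eq_derive_in A f g (x : R) : A x -> (forall y, A y -> f y = g y) ->
  derive_in A f x = derive_in A g x.
Proof.
move=> Ax fg; rewrite /derive_in; congr (lim _); apply/funext => P.
change ((x^' : set_system R) (fun y => A y -> P (diff_quot f x y)) =
  (x^' : set_system R) (fun y => A y -> P (diff_quot g x y))).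
congr (x^' _); apply/funext => y; apply/propext.
by split=> h Ay; move: (h Ay); rewrite /diff_quot !fg.
Qed.

End RelativeDerivative.

(** * Explicit Laplacian of the Gaussian test function *)

Section RadialTestFunction.
Context {R : realType}.
Variable al : R.

Lemma d_r_phi (r z : R) : 1 <= r ->
  d_r (phi al) r z = - (2 * al * r) * gauss al r * sin (pi * z).
Proof.
move=> r1; apply: derive_in_val; first exact: proper_r_dom.
have h := is_derive_gauss al r; rewrite /phi -/(gauss al _).
apply: is_derive_eq; rewrite /GRing.scale/=; ring.
Qed.

Lemma d_z_phi (r z : R) : 0 <= z <= 1 ->
  d_z (phi al) r z = gauss al r * (pi * cos (pi * z)).
Proof.
move=> hz; apply: derive_in_val; first exact: proper_z_dom.
have h := is_derive_sinpi z; rewrite /phi -/(gauss al _).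
apply: is_derive_eq; rewrite /GRing.scale/=; ring.
Qed.

Lemma PhiE (r z : R) : 1 <= r -> 0 <= z <= 1 ->
  Phi al r z = (4 * al ^+ 2 * r ^+ 2 - (8 * al + pi ^+ 2)) * gauss al r * sin (pi * z).
Proof.
move=> r1 hz; rewrite /Phi /laplace5.
have -> : d_r (d_r (phi al)) r z =
    (4 * al ^+ 2 * r ^+ 2 - 2 * al) * gauss al r * sin (pi * z).
  rewrite /d_r -/(d_r (phi al)).
  (* The closed form of the first derivative holds on [r >= 1], which is all that a derivative along
     that domain sees. *)
  rewrite (@eq_derive_in _ _ _ (fun s => - (2 * al * s) * gauss al s * sin (pi * z))); last 2 first.
    by rewrite /r_dom/= in_itv/= andbT.
    by move=> y; rewrite /r_dom/= in_itv/= andbT; exact: d_r_phi.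
  apply: derive_in_val; first exact: proper_r_dom.
  have h := is_derive_gauss al r.
  apply: is_derive_eq; rewrite /GRing.scale/=; ring.
have -> : d_z (d_z (phi al)) r z = - pi ^+ 2 * gauss al r * sin (pi * z).
  rewrite /d_z -/(d_z (phi al)).
  rewrite (@eq_derive_in _ _ _ (fun s => gauss al r * (pi * cos (pi * s)))); last 2 first.
    by rewrite /z_dom/= in_itv.
    by move=> y; rewrite /z_dom/= in_itv/=; exact: d_z_phi.
  apply: derive_in_val; first exact: proper_z_dom.
  have h := is_derive_cospi z.
  apply: is_derive_eq; rewrite /GRing.scale/=; ring.
rewrite d_r_phi//; field.
by rewrite lt0r_neq0// (lt_le_trans _ r1).
Qed.

End RadialTestFunction.

(** * Truncating a solution *)

Section Truncation.
Context {R : realType}.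
Variables (beta : R) (u0 psi0 : R -> R -> R) (T : \bar R) (u psi : R -> R -> R -> R).
Hypothesis sol : solution beta u0 psi0 T u psi.
Variables (tau eps : R).
Hypothesis tau0 : 0 < tau.
Hypothesis tauT : (tau%:E < T)%E.
Hypothesis eps0 : 0 < eps.
Let N := 1 + eps^-1.

Definition clamped (tau N : R) (f : R -> R -> R -> R) (t r z : R) : R :=
  f (clamp 0 tau t) (clamp 1 N r) (clamp 0 1 z).

Let N1 : 1 <= N.
Proof. by rewrite lerDl invr_ge0 ltW. Qed.

Let time_domP t : 0 <= t <= tau -> time_dom T t.
Proof.
by move=> /andP[t0 tt]; split => //; apply: le_lt_trans tauT; rewrite lee_fin.
Qed.

Let r_domP (r : R) : 1 <= r <= N -> r_dom R r.
Proof. by move=> /andP[r1 _]; rewrite /r_dom/= in_itv/= r1. Qed.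

Let z_domP (z : R) : 0 <= z <= 1 -> z_dom R z.
Proof. by move=> hz; rewrite /z_dom/= in_itv. Qed.

Let domP (t r z : R) : 0 <= t <= tau -> 1 <= r <= N -> 0 <= z <= 1 -> dom T (t, r, z).
Proof. by move=> ht hr hz; split; [exact: time_domP|exact: r_domP|exact: z_domP]. Qed.

(** Clamping is a continuous map into the domain, so continuity relative to the domain becomes
    continuity everywhere. *)
Lemma tame_clamped f : cont_on T f -> tame tau (clamped tau N f).
Proof.
move=> cf; split; last first.
  by move=> t; apply/funext => r; apply/funext => z; rewrite /clamped [in RHS](clamp_id (clamp_in _ (ltW tau0))).
pose c (p : R * R * R) := (clamp 0 tau p.1.1, clamp 1 N p.1.2, clamp 0 1 p.2).
have Dc p : dom T (c p).
  by apply: domP; apply: clamp_in => //; exact: ltW.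
have d1 := cont_comp (@cont_clamp R 0 tau) (@cont_fst_fst R R).
have d2 := cont_comp (@cont_clamp R 1 N) (@cont_snd_fst R R).
have d3 := cont_comp (@cont_clamp R 0 1) (@cont_snd R (R * R)%type).
have cc : continuous c.
  move=> p; exact: (cvg_pair (cvg_pair (d1 p) (d2 p)) (d3 p)).
move=> p; have /subspace_continuousP := cf => /(_ (c p) (Dc p)) h.
have cw : c q @[q --> p] --> within (dom T) (nbhs (c p)).
  move=> P hP; have hP' : nbhs (c p) (fun q => dom T q -> P q) by exact: hP.
  have hp : nbhs p (fun q => dom T (c q) -> P (c q)) by exact: (cc p _ hP').
  change (nbhs p (fun q => P (c q))).
  by apply: filterS hp => q; apply; exact: Dc.
exact: (cvg_comp _ _ cw h).
Qed.

Let near_itv (a b x : R) (P : R -> Prop) : a < x < b -> (forall y, a < y < b -> P y) ->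
  \near x, P x.
Proof.
move=> hx hP; have := @near_in_itvoo R a b x; rewrite in_itv/= => /(_ hx).
by apply: filterS => y; rewrite in_itv/=; exact: hP.
Qed.

(** Near an interior point clamping is the identity and the derivative along the domain is the
    two-sided one; the same holds for the other two variables. *)
Lemma is_derive_clamped_r f (t r z : R) : 0 <= t <= tau -> 1 < r < N -> 0 <= z <= 1 ->
  derivable_in (r_dom R) (fun s => f t s z) r ->
  is_derive r 1 (fun s => clamped tau N f t s z)
    (clamped tau N (fun t => d_r (f t)) t r z).
Proof.
move=> ht hr hz df.
have W (y : R) : 1 < y < N -> 1 <= y <= N by move=> /andP[y1 yN]; rewrite !ltW.
rewrite {2}/clamped !clamp_id//; last exact: W.
apply: (@near_eq_is_derive _ _ _ (fun s => f t s z)).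
  apply: (near_itv hr) => y hy.
  by rewrite /clamped !clamp_id//; exact: W.
apply: derive_in_interior => //; apply: (near_itv hr) => y hy.
exact/r_domP/W.
Qed.

Lemma is_derive_clamped_z f (t r z : R) : 0 <= t <= tau -> 1 <= r <= N -> 0 < z < 1 ->
  derivable_in (z_dom R) (fun s => f t r s) z ->
  is_derive z 1 (fun s => clamped tau N f t r s)
    (clamped tau N (fun t => d_z (f t)) t r z).
Proof.
move=> ht hr hz df.
have W (y : R) : 0 < y < 1 -> 0 <= y <= 1 by move=> /andP[y1 yN]; rewrite !ltW.
rewrite {2}/clamped !clamp_id//; last exact: W.
apply: (@near_eq_is_derive _ _ _ (fun s => f t r s)).
  apply: (near_itv hz) => y hy.
  by rewrite /clamped !clamp_id//; exact: W.
apply: derive_in_interior => //; apply: (near_itv hz) => y hy.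
exact/z_domP/W.
Qed.

Lemma is_derive_clamped_t f (t r z : R) : 0 < t < tau -> 1 <= r <= N -> 0 <= z <= 1 ->
  derivable_in (time_dom T) (fun s => f s r z) t ->
  is_derive t 1 (fun s => clamped tau N f s r z) (d_t T f t r z).
Proof.
move=> ht hr hz df.
have W (y : R) : 0 < y < tau -> 0 <= y <= tau by move=> /andP[y1 yN]; rewrite !ltW.
apply: (@near_eq_is_derive _ _ _ (fun s => f s r z)).
  apply: (near_itv ht) => y hy.
  by rewrite /clamped !clamp_id//; exact: W.
apply: derive_in_interior => //; apply: (near_itv ht) => y hy.
exact/time_domP/W.
Qed.

Hypothesis hpos : forall r z : R, 1 <= r -> 0 < z < 1 -> 0 < u0 r z ^+ 2.
Hypothesis hbd : forall r : R, 1 <= r -> u0 r 0 = 0 /\ u0 r 1 = 0.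

Lemma truncated_of_solution :
  truncated_solution (beta / 2) eps tau (clamped tau N u) (clamped tau N psi)
    (clamped tau N (fun t => d_r (psi t))) (clamped tau N (fun t => d_z (psi t)))
    (clamped tau N (fun t => d_r (d_r (psi t)))) (clamped tau N (fun t => d_z (d_z (psi t))))
    (clamped tau N (vort psi)) (clamped tau N (d_t T (vort psi))).
Proof.
have [[cu du _ _] [_ dtu _]] := sol_u_C1 sol.
have [[cpsi dpsi cpr cpz] [_ dpr cprr _] [_ dpz _ cpzz]] := sol_psi_C2 sol.
have [com dom cdom] := sol_vort_C1 sol.
have z0 : 0 <= (0 : R) <= 1 by rewrite lexx ler01.
have z1 : 0 <= (1 : R) <= 1 by rewrite lexx ler01.
have r1 : 1 <= (1 : R) <= N by rewrite lexx N1.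
have t0 : 0 <= (0 : R) <= tau by rewrite lexx ltW.
have W (b a y : R) : a < y < b -> a <= y <= b by move=> /andP[y1 yN]; rewrite !ltW.
split.
- exact: tame_clamped.
- exact: tame_clamped.
- exact: tame_clamped.
- exact: tame_clamped.
- exact: tame_clamped.
- exact: tame_clamped.
- exact: tame_clamped.
- exact: tame_clamped.
- move=> t r z ht hr hz; apply: is_derive_clamped_r => //.
  by have [] := dpsi t r z (domP ht (W _ _ _ hr) hz).
- move=> t r z ht hr hz; apply: (@is_derive_clamped_r (fun t => d_r (psi t))) => //.
  by have [] := dpr t r z (domP ht (W _ _ _ hr) hz).
- move=> t r z ht hr hz; apply: is_derive_clamped_z => //.
  by have [] := dpsi t r z (domP ht hr (W _ _ _ hz)).
- move=> t r z ht hr hz; apply: (@is_derive_clamped_z (fun t => d_z (psi t))) => //.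
  by have [] := dpz t r z (domP ht hr (W _ _ _ hz)).
(* The vorticity equation identifies [omt] with the derivative of [u ^+ 2] in [z], which the chain
   rule expresses through that of [u]. *)
- move=> t r z ht hr hz; have ht' := W _ _ _ ht; have hz' := W _ _ _ hz.
  have D := domP ht' hr hz'; have [_ duz] := du t r z D.
  rewrite {2}/clamped !clamp_id// (sol_eq_vort sol D).
  have h := is_derive_clamped_z ht' hr hz duz.
  have duz' : is_derive z 1 (u t r) (d_z (u t) r z).
    by apply: derive_in_interior => //; apply: (near_itv hz) => y hy; exact/z_domP/W.
  have du2 : is_derive z 1 (fun s => u t r s ^+ 2) (2 * u t r z * d_z (u t) r z).
    by apply: is_derive_eq; rewrite /GRing.scale/=; ring.
  have -> : d_z (fun r' z' => u t r' z' ^+ 2) r z = 2 * u t r z * d_z (u t) r z.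
    exact: (@derive_in_val R (z_dom R) _ z _ (proper_z_dom hz') du2).
  by apply: is_derive_eq; rewrite /GRing.scale/= /clamped !clamp_id//; ring.
- move=> t r z ht hr hz; have ht' := W _ _ _ ht; have D := domP ht' hr hz.
  have := is_derive_clamped_t ht hr hz (dtu t r z D).
  rewrite (sol_eq_u sol D) => /is_derive_eq; apply.
  by rewrite /clamped !clamp_id//; ring.
- move=> t r z ht hr hz; have ht' := W _ _ _ ht; have D := domP ht' hr hz.
  have := is_derive_clamped_t ht hr hz (dom t r z D).
  by move/is_derive_eq; apply; rewrite /clamped !clamp_id.
- move=> t r z ht hr hz; rewrite /clamped !clamp_id// /vort /laplace5.
  have r0 : r != 0 by move/andP: hr => [h _]; rewrite lt0r_neq0// (lt_le_trans _ h).
  by field.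
- move=> t z ht hz; rewrite /clamped !clamp_id//.
  (* The choice [alpha = beta / 2] is what gives the Gaussian the Robin coefficient of [psi]. *)
  rewrite (_ : 2 * (beta / 2) = beta); last by field.
  exact: (sol_bc_r sol (time_domP ht) (z_domP hz)).
- move=> t r ht hr; rewrite /clamped !clamp_id//.
  exact: (sol_bc_z sol (time_domP ht) (r_domP hr)).
- move=> r hr; rewrite /clamped !clamp_id//.
  have [-> _] := sol_init sol (r_domP hr) (z_domP z0).
  have [-> _] := sol_init sol (r_domP hr) (z_domP z1).
  by apply: hbd; case/andP: hr.
- move=> r z hr hz; rewrite /clamped !clamp_id//; last exact: W.
  have [-> _] := sol_init sol (r_domP hr) (z_domP (W _ _ _ hz)).
  have := hpos (proj1 (andP hr)) hz; rewrite exprn_even_gt0//.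
Qed.

End Truncation.

(** * The moments at the initial time *)

Section InitialMoments.
Context {R : realType}.
Local Notation mu2 := (@lebesgue_measure R \x @lebesgue_measure R)%E.
Local Notation RR := (measurableTypeR R * measurableTypeR R)%type.
Variable al : R.
Hypothesis al2 : 2 <= al.
Hypothesis alpi : 8 * al + pi ^+ 2 <= 4 * al ^+ 2.

(** The shift by 2 ensures [eps <= 2^-1]; the outer radius of [K n] is [n + 3]. *)
Definition eps_ (n : nat) : R := n.+2%:R^-1.
Local Notation K n := (rect 1 (1 + (eps_ n)^-1) 0 1).
Local Notation D := (r_dom R `*` z_dom R : set RR).

Lemma eps_gt0 n : 0 < eps_ n.
Proof. by rewrite invr_gt0 ltr0n. Qed.

Lemma eps_half n : eps_ n <= 2^-1.
Proof. by rewrite lef_pV2 ?posrE ?ltr0n// ler_nat. Qed.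

Lemma cvg_eps : eps_ n @[n --> \oo] --> 0.
Proof.
have := @cvg_harmonic R; rewrite -(@cvg_shiftS _ (harmonic : nat -> R)).
by apply: cvg_trans; apply: near_eq_cvg; near=> n.
Unshelve. all: by end_near. Qed.

Let Kin n (p : R * R) : K n p <-> 1 <= p.1 <= 1 + (eps_ n)^-1 /\ 0 <= p.2 <= 1.
Proof. by rewrite /rect/=; split=> [[]|[]] /=; rewrite !in_itv. Qed.

Let Din (p : R * R) : D p <-> 1 <= p.1 /\ 0 <= p.2 <= 1.
Proof. by rewrite /r_dom/z_dom/=; split=> [[]|[]] /=; rewrite !in_itv/= ?andbT. Qed.

Let KD n : K n `<=` D.
Proof. by move=> p /Kin[/andP[h1 _] h2]; apply/Din. Qed.

Let DK : D = \bigcup_n K n.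
Proof.
apply/seteqP; split=> [p /Din[h1 h2]|p [n _ /KD]//].
(* For this index the outer radius exceeds [Num.trunc p.1 + 1], which is above [p.1]. *)
exists (Num.trunc p.1) => //; apply/Kin; split=> //; rewrite h1/= /eps_ invrK.
apply: le_trans (ltW (truncnS_gt p.1)) _; rewrite -(natrD _ 1) ler_nat; exact: leq_trans (leqnSn _) (leqnSn _).
Qed.

Let mD : measurable D.
Proof. by rewrite DK; apply: bigcup_measurable => n _; exact: measurable_rect. Qed.

Variable g : R * R -> R.
Hypothesis mg : forall n, measurable_fun (K n : set RR) (g : RR -> R).

Let F n (p : R * R) : R := weight al (eps_ n) p.1 * (sin (pi * p.2) * g p).
Let h (p : R * R) : R := Phi al p.1 p.2 * g p * p.1 ^+ 3.
Let h' (p : R * R) : R :=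
  p.1 ^+ 3 * (4 * al ^+ 2 * p.1 ^+ 2 - (8 * al + pi ^+ 2)) * gauss al p.1 *
  sin (pi * p.2) * g p.

Let hE p : D p -> h p = h' p.
Proof. by move=> /Din[h1 h2]; rewrite /h /h' PhiE//; ring. Qed.

Let mgD : measurable_fun D (g : RR -> R).
Proof.
by rewrite DK; apply/measurable_fun_bigcup => // n; exact: measurable_rect.
Qed.

Let mF n : measurable_fun (K n : set RR) (F n : RR -> R).
Proof.
have cW := @cont_weight R al (eps_ n).
have h1 : measurable_fun (K n : set RR) ((fun p => weight al (eps_ n) p.1 * sin (pi * p.2)) : RR -> R).
  by apply: measurable_funTS; apply: continuous_measurable_plane; solve_cont.
have := measurable_funM h1 (@mg n); congr measurable_fun; apply/funext => p.
by rewrite /F /= mulrA.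
Qed.

Let mh : measurable_fun D (h : RR -> R).
Proof.
have cg := @cont_gauss R al.
have h1 : measurable_fun D ((fun p => p.1 ^+ 3 * (4 * al ^+ 2 * p.1 ^+ 2 - (8 * al + pi ^+ 2)) *
    gauss al p.1 * sin (pi * p.2)) : RR -> R).
  by apply: measurable_funTS; apply: continuous_measurable_plane; solve_cont.
have := measurable_funM h1 mgD; apply: eq_measurable_fun => p; rewrite inE => Dp.
by rewrite hE.
Qed.

Let F_bound n p : K n p -> `|F n p| <= 4 * `|h p|.
Proof.
move=> Kp; rewrite hE; last exact: KD Kp.
move: Kp => /Kin[h1 h2]; rewrite /F /h' mulrA normrM [X in 4 * X]normrM mulrA ler_wpM2r//.
have m0 := mult_ge0 al2 alpi (eps_gt0 n) (eps_half n) h1.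
have m4 := mult_le al2 alpi (eps_gt0 n) (eps_half n) h1.
have k0 := cut_ge0 (eps_gt0 n) h1; have k1 := cut_le1 (eps_gt0 n) h1.
have g0 : 0 <= gauss al p.1 := expR_ge0 _.
rewrite normrM [X in 4 * X]normrM mulrA ler_wpM2r//.
have b0 := base_ge0 al2 alpi (proj1 (andP h1)).
have r3 : 0 <= p.1 ^+ 3 by rewrite exprn_ge0// (le_trans ler01)//; case/andP: h1.
rewrite /weight !ger0_norm.
- rewrite -mulrA mulrC [leRHS](_ : _ = 4 * (p.1 ^+ 3 *
     (4 * al ^+ 2 * p.1 ^+ 2 - (8 * al + pi ^+ 2))) * gauss al p.1); last by ring.
  rewrite ler_wpM2r//; apply: le_trans m4.
  by rewrite ler_piMl// exprn_ile1.
- by rewrite mulr_ge0// mulr_ge0.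
- by rewrite mulr_ge0// mulr_ge0// exprn_ge0.
Qed.

(** At a fixed point the weight is continuous in [eps], its value at 0 is the untruncated one, and
    the point lies in [K n] for all large [n]. *)
Let F_cvg p : D p -> (F n \_ (K n)) p @[n --> \oo] --> h p.
Proof.
move=> Dp; rewrite hE//; move: Dp => /Din[h1 h2].
have cw : continuous (fun e : R => weight al e p.1).
  by rewrite /weight /mult /cut /gauss; solve_cont.
have w0 : weight al 0 p.1 = p.1 ^+ 3 *
    (4 * al ^+ 2 * p.1 ^+ 2 - (8 * al + pi ^+ 2)) * gauss al p.1.
  by rewrite /weight /mult /cut; ring.
have wc : weight al (eps_ n) p.1 @[n --> \oo] --> weight al 0 p.1.
  exact: (cvg_comp _ _ cvg_eps (cw 0)).
have Fc : F n p @[n --> \oo] --> h' p.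
  rewrite /F /h' -w0 -(mulrA (weight _ _ _)).
  exact: cvgMr_tmp wc.
apply: cvg_trans Fc; apply: near_eq_cvg; near=> n.
rewrite patchE mem_set//; apply/Kin; split=> //; rewrite h1/= /eps_ invrK.
have h3 : p.1 < n%:R by near: n; exact: nbhs_infty_gtr.
apply: le_trans (ltW h3) _; rewrite -(natrD _ 1) ler_nat.
exact: leq_trans (leqnSn _) (leq_trans (leqnSn _) (leqnSn _)).
Unshelve. all: by end_near. Qed.

(** Dominated convergence shows that the truncated integrals tend to the full one, so its positivity
    is inherited for all large [n]. *)
Lemma weight_integral_pos :
  0 < wint (fun r z => Phi al r z * g (r, z)) ->
  \forall n \near \oo, mu2.-integrable (K n) (EFin \o F n) /\
    0 < \int[mu2]_(p in K n) F n p.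
Proof.
have -> : wint (fun r z => Phi al r z * g (r, z)) = \int[mu2]_(p in D) h p.
  by apply: eq_Rintegral => -[r z] _.
move=> pos.
have ih : mu2.-integrable D (EFin \o h).
  apply/integrableP; split; first exact/measurable_EFinP.
  (* [fine] sends infinite values to 0, so a positive [wint] forces a finite integral, hence
     integrability of [h]. *)
  rewrite (integral_fin_num_abs mu2 mD mh).
  by move: pos; rewrite /Rintegral; case: (\int[_]_(_ in _) _)%E => //=; rewrite ltxx.
have ih4 : mu2.-integrable D (EFin \o (fun p => 4 * `|h p|)).
  have := integrableZl mD 4 (integrable_norm ih).
  by congr (_.-integrable _ _); apply/funext => p /=; rewrite EFinM.
have iF n : mu2.-integrable (K n) (EFin \o F n).
  have ik : mu2.-integrable (K n) (EFin \o (fun p => 4 * `|h p|)).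
    exact: (integrableS mD (measurable_rect _ _ _ _) (@KD n) ih4).
  apply: le_integrable ik; first exact: measurable_rect.
    exact/measurable_EFinP.
  move=> p Kp /=; rewrite lee_fin; apply: le_trans (F_bound Kp) _.
  exact: ler_norm.
have mFK n : measurable_fun D (EFin \o (F n \_ (K n)) : RR -> \bar R).
  apply/measurable_EFinP; apply/(measurable_restrict _ (measurable_rect _ _ _ _) mD).
  apply: measurable_funS (@mF n); first exact: measurable_rect.
  exact: subIsetr.
have mhE : measurable_fun D (EFin \o h : RR -> \bar R) by exact/measurable_EFinP.
have FKh : {ae mu2, forall p, D p -> (EFin \o (F n \_ (K n))) p @[n --> \oo] --> (EFin \o h) p}.
  apply: aeW => p Dp; apply: cvg_EFin; first exact: nearW.
  exact: F_cvg.
have FKb : {ae mu2, forall p n, D p ->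
    (`|(EFin \o (F n \_ (K n))) p| <= (4 * `|h p|)%R%:E)%E}.
  apply: aeW => p n Dp; rewrite /= lee_fin patchE; case: ifPn => [|_].
    by rewrite inE; exact: F_bound.
  by rewrite normr0 mulr_ge0.
have [_ _ cvF] := dominated_convergence mD mFK mhE FKh ih4 FKb.
have fin : (\int[mu2]_(p in D) (h p)%:E)%E \is a fin_num by exact: integrable_fin_num ih.
have cvR : (\int[mu2]_(p in K n) F n p) @[n --> \oo] --> \int[mu2]_(p in D) h p.
  have -> : (fun n => \int[mu2]_(p in K n) F n p) =
      fine \o (fun n => \int[mu2]_(p in D) (EFin \o (F n \_ (K n))) p)%E.
    apply/funext => n /=; rewrite -[RHS]/(\int[mu2]_(p in D) (F n \_ (K n)) p).
    by rewrite -Rintegral_mkcondr (setIidr (@KD n)).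
  by apply: fine_cvg; rewrite /Rintegral fineK.
near=> n; split; first exact: iF.
by near: n; exact: (cvgr_gt _ cvR 0 pos).
Unshelve. all: by end_near.
Qed.

End InitialMoments.

(** * A bound on the existence time in terms of the data *)

Section Lifespan.
Context {R : realType}.
Local Notation mu2 := (@lebesgue_measure R \x @lebesgue_measure R)%E.
Variables (beta : R) (u0 psi0 : R -> R -> R).
Hypothesis hpos : forall r z : R, 1 <= r -> 0 < z < 1 -> 0 < u0 r z ^+ 2.
Hypothesis hbd : forall r : R, 1 <= r -> u0 r 0 = 0 /\ u0 r 1 = 0.
Hypothesis hbeta : 2 + 2 * Num.sqrt (1 + pi ^+ 2 / 4) <= beta.
Let al := beta / 2.
Local Notation K n := (rect 1 (1 + (@eps_ R n)^-1) 0 1).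

(** The condition on [beta] puts [al] at or beyond the larger root, 1 + sqrt(1 + pi^2/4), of 4 x^2 -
    8 x - pi^2, and this root is at least 2. *)
Lemma half_beta : 2 <= al /\ 8 * al + pi ^+ 2 <= 4 * al ^+ 2.
Proof.
have hb := hbeta; set s := Num.sqrt _ in hb.
have p2 : 0 <= pi ^+ 2 :> R by exact: sqr_ge0.
have s2 : s ^+ 2 = 1 + pi ^+ 2 / 4 by rewrite sqr_sqrtr// addr_ge0// divr_ge0.
have s0 : 0 <= s by exact: sqrtr_ge0.
have s1 : 1 <= s.
  by rewrite -[1]sqrtr1 ler_wsqrtr// lerDl divr_ge0.
have e : beta = 2 * al by rewrite /al; field.
rewrite e in hb.
have hs : 1 + s <= al by lra.
split; first lra.
have : 0 <= (al - 1 - s) * (al - 1 + s) by rewrite mulr_ge0//; lra.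
have -> : (al - 1 - s) * (al - 1 + s) = al ^+ 2 - 2 * al + 1 - s ^+ 2 by ring.
rewrite s2; lra.
Qed.

Let al2 := proj1 half_beta.
Let alpi := proj2 half_beta.

Definition log_u0 (p : R * R) : R := ln (u0 p.1 p.2 ^+ 2).
Definition flux_psi0 (p : R * R) : R := d_z psi0 p.1 p.2.

Let Kin n (p : R * R) : K n p -> 1 <= p.1 <= 1 + (eps_ n)^-1 /\ 0 <= p.2 <= 1.
Proof. by case=> /=; rewrite !in_itv. Qed.

Section WithSolution.
Variables (T : \bar R) (u psi : R -> R -> R -> R).
Hypothesis sol : solution beta u0 psi0 T u psi.
Variable tau : R.
Hypothesis tau0 : 0 < tau.
Hypothesis tauT : (tau%:E < T)%E.

Let T0 : time_dom T 0.
Proof. by split => //; apply: lt_trans tauT; rewrite lte_fin. Qed.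

Lemma clamped_u0 n p : K n p ->
  clamped tau (1 + (eps_ n)^-1) u 0 p.1 p.2 = u0 p.1 p.2.
Proof.
move=> /Kin[h1 h2]; have h0 : 0 <= (0 : R) <= tau by rewrite lexx ltW.
rewrite /clamped !clamp_id//.
have hr : r_dom R p.1 by rewrite /r_dom/= in_itv/= andbT; case/andP: h1.
have hz : z_dom R p.2 by rewrite /z_dom/= in_itv.
by have [] := sol_init sol hr hz.
Qed.

Lemma clamped_flux0 n p : K n p ->
  clamped tau (1 + (eps_ n)^-1) (fun t => d_z (psi t)) 0 p.1 p.2 = d_z psi0 p.1 p.2.
Proof.
move=> /Kin[h1 h2]; have h0 : 0 <= (0 : R) <= tau by rewrite lexx ltW.
rewrite /clamped !clamp_id//.
apply: eq_derive_in; first by rewrite /z_dom/= in_itv.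
have hr : r_dom R p.1 by rewrite /r_dom/= in_itv/= andbT; case/andP: h1.
by move=> y hy; have [] := sol_init sol hr hy.
Qed.

(** Measurability of the data is read off a solution, whose initial slice is continuous and agrees
    with the data on [K n]. *)
Lemma measurable_log_u0 n : measurable_fun
  (K n : set (measurableTypeR R * measurableTypeR R)) (log_u0 : measurableTypeR R * measurableTypeR R -> R).
Proof.
have [[cu _ _ _] _] := sol_u_C1 sol.
have [cc _] := tame_clamped tau0 tauT (@eps_gt0 R n) cu.
have cs : continuous (fun p : R * R => clamped tau (1 + (eps_ n)^-1) u 0 p.1 p.2 ^+ 2).
  by solve_cont.
have := measurableT_comp (@measurable_ln R) (continuous_measurable_plane cs).
move=> /(@measurable_funTS _ _ _ _ (K n)); apply: eq_measurable_fun => p.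
by rewrite inE /log_u0 /= => Kp; rewrite clamped_u0.
Qed.

Lemma measurable_flux_psi0 n : measurable_fun
  (K n : set (measurableTypeR R * measurableTypeR R)) (flux_psi0 : measurableTypeR R * measurableTypeR R -> R).
Proof.
have [[_ _ _ cpz] _ _] := sol_psi_C2 sol.
have [cc _] := tame_clamped tau0 tauT (@eps_gt0 R n) cpz.
have cs : continuous (fun p : R * R => clamped tau (1 + (eps_ n)^-1) (fun t => d_z (psi t)) 0 p.1 p.2).
  by solve_cont.
have := continuous_measurable_plane cs.
move=> /(@measurable_funTS _ _ _ _ (K n)); apply: eq_measurable_fun => p.
by rewrite inE /flux_psi0 /= => Kp; rewrite clamped_flux0.
Qed.

End WithSolution.

(** The truncation index is chosen from the initial moments, which all solutions share; a solution
    living longer than the bound would contain a time interval [[0, tau]] violating it. *)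
Lemma solution_time_bound :
  0 < wint (fun r z => Phi al r z * ln (u0 r z ^+ 2)) ->
  0 < wint (fun r z => Phi al r z * d_z psi0 r z) ->
  exists Tmax : R, forall T u psi, (0 < T)%E ->
    solution beta u0 psi0 T u psi -> (T <= Tmax%:E)%E.
Proof.
move=> A0 B0.
have between (T : \bar R) (M : R) : 0 <= M -> (M%:E < T)%E ->
    exists2 tau : R, M < tau & (tau%:E < T)%E.
  case: T => [r| |] M0 //=.
    rewrite lte_fin => Mr; exists ((M + r) / 2); first by lra.
    by rewrite lte_fin; lra.
  by move=> _; exists (M + 1); rewrite ?ltrDl// ltry.
(* If some solution exists it supplies measurability of the data; otherwise the bound holds
   vacuously. *)
have [[T1 [u1 [psi1 [T10 sol1]]]]|nosol] := pselect (exists T u psi,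
    (0 < T)%E /\ solution beta u0 psi0 T u psi); last first.
  by exists 0 => T u psi T0 sol; exfalso; apply: nosol; exists T, u, psi.
have [tau1 tau10 tau1T] := between T1 0 (lexx _) T10.
have ev1 := weight_integral_pos al2 alpi (g := log_u0)
  (fun n => measurable_log_u0 sol1 tau10 tau1T (n := n)) A0.
have ev2 := weight_integral_pos al2 alpi (g := flux_psi0)
  (fun n => measurable_flux_psi0 sol1 tau10 tau1T (n := n)) B0.
have [n [[i1 p1] [_ p2]]] := filter_ex (filterI ev1 ev2).
have [Tmax hT] := truncated_time_bound al2 alpi (@eps_gt0 R n) (@eps_half R n) p1 p2.
(* The maximum with 0 makes the intermediate time [tau] positive as well as larger than [Tmax]. *)
exists (Num.max 0 Tmax) => T u psi T0 sol; rewrite leNgt; apply/negP => hlt.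
have M0 : 0 <= Num.max 0 Tmax by rewrite le_max lexx.
have [tau tauM tauT] := between T _ M0 hlt.
have tau0 : 0 < tau := le_lt_trans M0 tauM.
have ts := truncated_of_solution sol tau0 tauT (@eps_gt0 R n) hpos hbd.
have Eu : {in K n, forall p, weight al (eps_ n) p.1 * (sin (pi * p.2) *
      ln (clamped tau (1 + (eps_ n)^-1) u 0 p.1 p.2 ^+ 2)) =
    weight al (eps_ n) p.1 * (sin (pi * p.2) * log_u0 p)}.
  by move=> p; rewrite inE => Kp; rewrite (clamped_u0 sol tau0 Kp).
have : tau <= Tmax.
  apply: (hT _ _ _ _ _ _ _ _ _ tau0 ts).
  - by apply: eq_integrable i1; [exact: measurable_rect|move=> p Kp /=; rewrite Eu].
  - exact: eq_Rintegral.
  - apply: eq_Rintegral => p; rewrite inE => Kp.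
    by rewrite (clamped_flux0 sol tau0 Kp).
by rewrite leNgt (le_lt_trans _ tauM)// le_max lexx orbT.
Qed.

End Lifespan.

Theorem theorem2p2 (R : realType) (beta : R) (u0 psi0 : R -> R -> R)
  (hS : S_exterior beta)
  (hu0 : sobolev 3 (Omega_ext R) (axisym u0))
  (hpsi0 : sobolev 4 (Omega_ext R) (axisym psi0))
  (hpos : forall r z : R, 1 <= r -> 0 < z < 1 -> 0 < u0 r z ^+ 2)
  (hbd : forall r : R, 1 <= r -> u0 r 0 = 0 /\ u0 r 1 = 0)
  (hbeta : 2 + 2 * Num.sqrt (1 + pi ^+ 2 / 4) <= beta) :
  let alpha := beta / 2 in
  let A := wint (fun r z => Phi alpha r z * ln (u0 r z ^+ 2)) in
  let B := wint (fun r z => Phi alpha r z * d_z psi0 r z) in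
  0 < A -> 0 < B -> 16 / c0 alpha * A ^+ 3 <= B ^+ 2 ->
  finite_time_singularity beta u0 psi0.
Proof.
move=> alpha A B A0 B0 _.
have [Tmax hT] := solution_time_bound hpos hbd hbeta A0 B0.
split.
  (* Every time in the supremum carries a solution, so the supremum is at most [Tmax]. *)
  apply: le_lt_trans (ltry Tmax); apply: ge_ereal_sup => T /= [T0 [u [psi [sol _]]]].
  exact: hT sol.
move=> [u [psi sol]]; have := hT +oo%E u psi (ltry 0) sol.
by rewrite leye_eq.
Qed.
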